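(* Let $p\in \mathbb{C}[z_1,z_2]$ be stable. If $p(0)=1$, then for all $z=(z_1,z_2)\in\mathbb{C}^2$, \[ |p(z)|\leq\exp\left(\operatorname{Re}\Big(\sum_{j=1}^{2} z_j p_j(0)\Big) + \frac{1}{2}\|z\|_{\infty}^2 \left(\Big|\sum_{j=1}^{2} p_j(0)\Big|^2-\operatorname{Re}\Big(\sum_{j,k=1}^{2} p_{j,k}(0)\Big)\right)\right). \]
   Context: A polynomial $p\in\mathbb{C}[z_1,\dots,z_n]$ is called stable if it has no zeros in $(\mathbb{C}_+)^n$, where $\mathbb{C}_+=\{z\in\mathbb{C}:\operatorname{Im} z>0\}$. Notation: $p_j = \frac{\partial p}{\partial z_j}$, $p_{j,k} = \frac{\partial^2 p}{\partial z_j \partial z_k}$, and $\|z\|_\infty=\max_j|z_j|$. *)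

(* Defs.v *)
From HB Require Import structures.
From mathcomp Require Import all_boot all_order all_algebra.
From mathcomp Require Import complex.
From mathcomp Require Import reals sequences exp.
(* Not imported: the notations of mpoly clash with those of mathcomp-analysis. *)
From mathcomp Require mpoly.

Set Implicit Arguments.
Unset Strict Implicit.
Unset Printing Implicit Defensive.

Import Order.TTheory GRing.Theory Num.Theory.
Local Open Scope ring_scope.

(* Complex polynomials in n variables are [mpoly.mpoly n R[i]], and points of
   C^n are functions ['I_n -> R[i]], as expected by [mpoly.meval]. *)

Definition stable (R : realType) (n : nat) (p : mpoly.mpoly n R[i]) : Prop :=
  forall z : 'I_n -> R[i],
    (forall j, 0 < complex.Im (z j)) -> mpoly.meval z p != 0.

(* [Normc.normc] is the modulus with values in R, whereas the norm of R[i] as a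
   numDomainType has values in R[i]. *)
Definition sup_norm (R : realType) (n : nat) (z : 'I_n -> R[i]) : R :=
  \big[Num.max/0]_(j < n) Normc.normc (z j).

(* First and second partial derivatives of p at the origin. *)
Definition partial0 (R : realType) (n : nat) (p : mpoly.mpoly n R[i])
    (j : 'I_n) : R[i] :=
  mpoly.meval (fun _ => 0) (mpoly.mderiv j p).

Definition partial20 (R : realType) (n : nat) (p : mpoly.mpoly n R[i])
    (j k : 'I_n) : R[i] :=
  mpoly.meval (fun _ => 0) (mpoly.mderiv j (mpoly.mderiv k p)).

(* Main.v *)
Require Import Defs.
From HB Require Import structures.
From mathcomp Require Import all_boot all_order all_algebra.
From mathcomp Require Import complex.
From mathcomp Require Import reals sequences exp.
From mathcomp Require Import classical_sets topology normedtype.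
From mathcomp Require Import zify ring lra.
From mathcomp Require mpoly.
From mathcomp Require Import -(notations) mpoly.
Import Order.TTheory GRing.Theory Num.Theory.
Local Open Scope ring_scope.

Set Implicit Arguments.
Unset Strict Implicit.
Unset Printing Implicit Defensive.

(**
Let G be a d by d matrix with positive semidefinite imaginary part of rank
one, say G = - A + i v v^* with A Hermitian, and let B1, B2 be complementary
orthogonal projections. When p(z) is a constant multiple of
det (G + z1 B1 + z2 B2) and p(0) = 1, the bound is linear algebra. Put
K = G^-1, so p(z) = det (1 + W) with W = K (z1 B1 + z2 B2); each eigenvalue l
of W satisfies |1 + l|^2 <= exp (2 Re l + |l|^2), whence
|p(z)|^2 <= exp (2 Re tr W + ||W||^2) in the Frobenius norm (Schur). Here
tr W is the linear term of p, and ||W|| <= ||z||_oo ||K|| because z1 B1 + z2 B2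
is normal with eigenvalues z1, z2. Finally K = X - i u u^* with X
Hermitian, and a rank one imaginary part is exactly what makes
||K||^2 = |tr K|^2 - Re ((tr K)^2 - tr K^2); the right-hand side is
the second order quantity of the statement, read off from
p(t, t) = det (1 + t K). This is [frobenius_orthogonal_split],
[frobenius_rank1_imaginary] and [strictly_stable_eigenvalues].

The substance is thus the determinantal formula
([determinantal_representation]). In the coordinates
q(x, y) = p(x - y, x + y), normalized to be monic in x, stability says that
for real y all roots in x lie in the open lower half-plane. Write q = f + i g
with f, g real on real points. The Bezoutian B(y) of f and g is a Hermitian
matrix polynomial in y, positive definite for real y by Hermite's theorem
([hermite_criterion]), and it symmetrizes the companion matrix T of f: B T is
Hermitian. By the matrix Fejer-Riesz theorem B = E^# E, where ^# is the
conjugate transpose on the real line and E can be chosen with all zeros of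
its determinant in the lower half-plane ([fejer_riesz_outer]). Then
M = E T E^-1 is Hermitian on the real line, so its poles would lie both among
the zeros of det E and among their conjugates: M is a polynomial matrix
([selfadjoint_conjugate]). Since tr M^2 = tr T^2 has degree at most 2 in y, M
has degree at most 1, so M = A + y D. The last column v of E satisfies
v^# v = coefficient of x^(d-1) in g, of degree at most 1, so v is constant. As
the companion matrix of q is that of f minus i times a rank one matrix built
from g, conjugating by E gives q(x, y) = det (x - A - y D + i v v^* ). When the
top degree part of p is a monomial c z1^n z2^n, that of q is (x^2 - y^2)^n,
which forces D^2 = 1 and yields B1, B2 = (1 + D)/2, (1 - D)/2
([leading_form_square]).

An arbitrary stable p is reduced to this case by composing both variables with
z |-> (z + i e)/(1 - i e z), which maps the closed upper half-plane and infinity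
into the open upper half-plane, clearing denominators, and letting e tend
to 0 ([mobius_pullback_strictly_stable], [stable_bound]).
*)

(** * Matrix Fejer-Riesz factorization on the real line *)

Section FejerRiesz.
Local Open Scope sesquilinear_scope.
Variable C : numClosedFieldType.
Implicit Types (l t : C) (p q : {poly C}).

Definition polyconj (p : {poly C}) : {poly C} := map_poly Num.conj p.
HB.instance Definition _ := GRing.RMorphism.copy polyconj (map_poly (@Num.conj C)).

Lemma polyconjK : involutive polyconj.
Proof. by move=> p; apply/polyP => i; rewrite !coef_map /= conjCK. Qed.

Lemma horner_polyconj p t : (polyconj p).[t] = (p.[t^*])^*.
Proof. by rewrite /polyconj -{1}[t]conjCK horner_map. Qed.

Lemma polyconj_XsubC l : polyconj ('X - l%:P) = 'X - (l^*)%:P.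
Proof. by rewrite /polyconj rmorphB /= map_polyX map_polyC. Qed.

(** The adjoint ^# on matrix polynomials: at a real point it is the conjugate
transpose of the value, and [evalmx_adjmx] gives it elsewhere. *)
Definition adjmx m n (A : 'M[{poly C}]_(m, n)) : 'M[{poly C}]_(n, m) :=
  map_mx polyconj A^T.

Definition evalmx t m n (A : 'M[{poly C}]_(m, n)) : 'M[C]_(m, n) :=
  map_mx (horner_eval t) A.

Lemma adjmxK m n (A : 'M[{poly C}]_(m, n)) : adjmx (adjmx A) = A.
Proof. by apply/matrixP => i j; rewrite !mxE polyconjK. Qed.

Lemma adjmxM m n k (A : 'M[{poly C}]_(m, n)) (B : 'M_(n, k)) :
  adjmx (A *m B) = adjmx B *m adjmx A.
Proof. by rewrite /adjmx trmx_mul map_mxM. Qed.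

Lemma adjmxD m n (A B : 'M[{poly C}]_(m, n)) : adjmx (A + B) = adjmx A + adjmx B.
Proof. by rewrite /adjmx linearD map_mxD. Qed.

Lemma adjmxZ m n a (A : 'M[{poly C}]_(m, n)) :
  adjmx (a *: A) = polyconj a *: adjmx A.
Proof. by rewrite /adjmx linearZ map_mxZ. Qed.

Lemma det_adjmx n (A : 'M[{poly C}]_n) : \det (adjmx A) = polyconj (\det A).
Proof. by rewrite det_map_mx det_tr. Qed.

Lemma adjmx_polyC m n (A : 'M[C]_(m, n)) :
  adjmx (map_mx polyC A) = map_mx polyC (A ^t*).
Proof. by apply/matrixP => i j; rewrite !mxE /polyconj map_polyC. Qed.

Lemma evalmxM t m n k (A : 'M[{poly C}]_(m, n)) (B : 'M_(n, k)) :
  evalmx t (A *m B) = evalmx t A *m evalmx t B.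
Proof. exact: map_mxM. Qed.

Lemma evalmxZ t m n a (A : 'M[{poly C}]_(m, n)) :
  evalmx t (a *: A) = a.[t] *: evalmx t A.
Proof. exact: map_mxZ. Qed.

Lemma evalmx_polyC t m n (A : 'M[C]_(m, n)) : evalmx t (map_mx polyC A) = A.
Proof. by apply/matrixP => i j; rewrite !mxE /horner_eval hornerC. Qed.

Lemma det_evalmx t n (A : 'M[{poly C}]_n) : \det (evalmx t A) = (\det A).[t].
Proof. by rewrite det_map_mx. Qed.

Lemma evalmx_adjmx t m n (A : 'M[{poly C}]_(m, n)) :
  evalmx t (adjmx A) = (evalmx t^* A) ^t*.
Proof. by apply/matrixP => i j; rewrite !mxE /horner_eval horner_polyconj. Qed.

Lemma scalemx_injr m n (a : {poly C}) (A B : 'M[{poly C}]_(m, n)) :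
  a != 0 -> a *: A = a *: B -> A = B.
Proof.
move=> a0 /matrixP e; apply/matrixP => i j; move: (e i j); rewrite !mxE.
exact: mulfI.
Qed.

Lemma evalmx_root l m n (A : 'M[{poly C}]_(m, n)) :
  evalmx l A = 0 -> exists A', A = ('X - l%:P) *: A'.
Proof.
move=> /matrixP A0; exists (\matrix_(i, j) (A i j %/ ('X - l%:P))).
apply/matrixP => i j; rewrite !mxE mulrC divpK // dvdp_XsubCl /root.
by move: (A0 i j); rewrite !mxE /horner_eval => ->.
Qed.

Lemma sqnorm_row_ge0 n (u : 'rV[C]_n) : 0 <= (u *m u ^t*) 0 0.
Proof. by rewrite mxE sumr_ge0 // => i _; rewrite !mxE mul_conjC_ge0. Qed.

Lemma sqnorm_row_gt0 n (u : 'rV[C]_n) : u != 0 -> 0 < (u *m u ^t*) 0 0.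
Proof.
move=> u0; rewrite lt_def sqnorm_row_ge0 andbT; apply: contra u0 => /eqP.
rewrite mxE => /eqP; rewrite psumr_eq0 => [/allP h|i _]; last first.
  by rewrite !mxE mul_conjC_ge0.
apply/eqP/rowP => i; move: (h i (mem_index_enum _)).
by rewrite !mxE mul_conjC_eq0 => /eqP.
Qed.

(** The last property says that P kills the orthogonal complement of the column
space of A; P is S^* S for an orthonormal basis S of the rows of A^*. *)
Lemma orthogonal_projector n m (A : 'M[C]_(n, m)) :
  exists P : 'M[C]_n, [/\ P ^t* = P, P *m P = P, P *m A = A &
    forall k (Y : 'M[C]_(n, k)), A ^t* *m Y = 0 -> P *m Y = 0].
Proof.
pose R := row_base (A ^t*); pose S := schmidt R.
have rn : (\rank (A ^t*) <= n)%N by rewrite rank_leq_col.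
have Su : S *m S ^t* = 1%:M by apply/unitarymxP/schmidt_unitarymx.
have SA : (S :=: A ^t*)%MS.
  by apply: eqmx_trans (eq_row_base _); apply: eqmx_schmidt_free; apply: row_base_free.
exists (S ^t* *m S); split.
- by rewrite trmx_mul map_mxM trmxCK.
- by rewrite mulmxA -[_ *m S *m S ^t*]mulmxA Su mulmx1.
- have /submxP[X AX] : (A ^t* <= S)%MS by rewrite SA.
  have AE : A = S ^t* *m X ^t* by rewrite -map_mxM -trmx_mul -AX trmxCK.
  suff : S ^t* *m S *m (S ^t* *m X ^t*) = S ^t* *m X ^t* by rewrite -AE.
  by rewrite mulmxA -[_ *m S *m S ^t*]mulmxA Su mulmx1.
- move=> k Y AY; have /submxP[X ->] : (S <= A ^t*)%MS by rewrite SA.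
  by rewrite -!mulmxA AY !mulmx0.
Qed.

(** Evaluating the hypothesis at l^* makes the columns of H at l orthogonal to
those of H at l^*. With P the projector on the former, (1 - P) H vanishes at l
and P H at l^*, so H1 = (1 - P) H / (X - l) + P H / (X - l^* ) is polynomial;
it differs from H by a factor whose square modulus on the real line is
the scalar to be removed. *)
Lemma peel_quadratic_factor n m l (H : 'M[{poly C}]_(n, m)) (B : 'M_m) :
  adjmx H *m H = (('X - l%:P) * ('X - (l^*)%:P)) *: B ->
  exists H1 : 'M_(n, m), adjmx H1 *m H1 = B.
Proof.
move=> HB; have [P [Pt PP PH P0]] := orthogonal_projector (evalmx l H).
have orth : (evalmx l H) ^t* *m evalmx l^* H = 0.
  rewrite -{1}[l]conjCK -evalmx_adjmx -evalmxM HB evalmxZ hornerM !hornerXsubC.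
  by rewrite subrr mulr0 scale0r.
pose Pc : 'M[{poly C}]_n := map_mx polyC P.
have PcH : Pc *m Pc = Pc by rewrite -map_mxM PP.
have Pca : adjmx Pc = Pc by rewrite adjmx_polyC Pt.
have [U1 e1] : exists U, H - Pc *m H = ('X - l%:P) *: U.
  apply: evalmx_root; rewrite /evalmx map_mxB map_mxM.
  by rewrite [map_mx _ Pc]evalmx_polyC [map_mx _ H]/(evalmx _ _) PH subrr.
have [U2 e2] : exists U, Pc *m H = ('X - (l^*)%:P) *: U.
  by apply: evalmx_root; rewrite evalmxM evalmx_polyC P0.
have nz k : 'X - k%:P != 0 :> {poly C} by rewrite polyXsubC_eq0.
exists (U1 + U2); rewrite adjmxD mulmxDl !mulmxDr.
have a1 : adjmx H - adjmx H *m Pc = ('X - (l^*)%:P) *: adjmx U1.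
  rewrite -polyconj_XsubC -adjmxZ -e1 /adjmx linearB /= map_mxB trmx_mul map_mxM.
  by rewrite -/(adjmx Pc) Pca.
have a2 : adjmx H *m Pc = ('X - l%:P) *: adjmx U2.
  have <- : polyconj ('X - (l^*)%:P) = 'X - l%:P by rewrite polyconj_XsubC conjCK.
  by rewrite -adjmxZ -e2 adjmxM Pca.
have U12 : adjmx U1 *m U2 = 0.
  apply: (@scalemx_injr _ _ (('X - (l^*)%:P) * ('X - (l^*)%:P))).
    by rewrite mulf_neq0.
  rewrite scaler0 -scalerA scalemxAr scalemxAl -a1 -e2.
  by rewrite mulmxBl !mulmxA -[_ *m Pc *m Pc]mulmxA PcH subrr.
have U21 : adjmx U2 *m U1 = 0.
  by rewrite -[U1]adjmxK -adjmxM U12 /adjmx trmx0 map_mx0.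
rewrite U12 U21 addr0 add0r.
apply: (@scalemx_injr _ _ (('X - l%:P) * ('X - (l^*)%:P))); first by rewrite mulf_neq0.
rewrite -HB scalerDr.
have -> : (('X - l%:P) * ('X - (l^*)%:P)) *: (adjmx U1 *m U1) =
   (adjmx H - adjmx H *m Pc) *m (H - Pc *m H).
  by rewrite a1 e1 -scalemxAl -scalemxAr scalerA mulrC.
have -> : (('X - l%:P) * ('X - (l^*)%:P)) *: (adjmx U2 *m U2) =
   (adjmx H *m Pc) *m (Pc *m H).
  by rewrite a2 e2 -scalemxAl -scalemxAr scalerA.
by rewrite mulmxBl !mulmxBr !mulmxA -!(mulmxA _ Pc Pc) PcH subrr subr0 subrK.
Qed.


Lemma eq_poly_real p q : (forall t, t \is Num.real -> p.[t] = q.[t]) -> p = q.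
Proof.
move=> pq; apply/eqP; rewrite -subr_eq0; apply/negPn/negP => nz.
pose rs : seq C := [seq i%:R | i <- iota 0 (size (p - q))].
have := @max_poly_roots _ _ rs nz.
rewrite size_map size_iota ltnn => h; suff : false by [].
apply: h.
  apply/allP => x /mapP[i _ ->]; rewrite /root hornerD hornerN pq ?subrr //.
rewrite map_inj_uniq ?iota_uniq // => i j /eqP; rewrite eqr_nat; exact/eqP.
Qed.

(** The roots of b come in conjugate pairs, none of them real: remove the pairs
one at a time. *)
Lemma peel_positive_factor n m (b : {poly C}) (H : 'M[{poly C}]_(n, m)) (B : 'M_m) :
  (forall t, t \is Num.real -> 0 < b.[t]) -> adjmx H *m H = b *: B ->
  exists E : 'M_(n, m), adjmx E *m E = B.
Proof.
have [k] := ubnP (size b); elim: k b H B => // k IH b H B sb bpos HB.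
have bR : polyconj b = b.
  apply: eq_poly_real => t tR; rewrite horner_polyconj (conj_Creal tR).
  by rewrite conj_Creal // ger0_real // ltW // bpos.
have [sb1|] := leqP (size b) 1.
  have bE : b = (b.[0])%:P by rewrite {1}(size1_polyC sb1) horner_coef0.
  have b0 : 0 < b.[0] by rewrite bpos // real0.
  exists (((sqrtC b.[0])^-1)%:P *: H).
  rewrite adjmxZ -scalemxAl -scalemxAr HB [X in X *: B]bE !scalerA.
  have sR : (sqrtC b.[0])^* = sqrtC b.[0].
    by rewrite conj_Creal // ger0_real // sqrtC_ge0 ltW.
  rewrite /polyconj map_polyC /= fmorphV /= sR -!polyCM -invfM -expr2 sqrtCK mulVf ?gt_eqF //.
  by rewrite scale1r.
move=> sb1; have /closed_rootP[l rl] : size b != 1 by rewrite gtn_eqF.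
have lR : l \isn't Num.real.
  apply/negP => /bpos; move: rl; rewrite /root => /eqP ->; by rewrite ltxx.
have ll : l^* != l by apply: contra lR => /eqP/CrealP.
have [b1 b1E] : exists b1, b = b1 * ('X - l%:P) by apply/factor_theorem.
have : root b l^*.
  by rewrite -bR /root horner_polyconj conjCK (eqP rl) rmorph0.
rewrite b1E rootM root_XsubC (negbTE ll) orbF => /factor_theorem[b2 b2E].
have bE : b = b2 * (('X - l%:P) * ('X - (l^*)%:P)).
  by rewrite b1E b2E mulrAC mulrA.
have b0 : b != 0 by rewrite -size_poly_gt0 (leq_trans _ sb1).
have b20 : b2 != 0 by apply: contra b0; rewrite bE => /eqP ->; rewrite mul0r.
have [|H1 H1E] := @peel_quadratic_factor n m l H (b2 *: B).
  by rewrite HB bE mulrC scalerA.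
apply: (IH b2 H1 B) => // [|t tR].
  move: sb; rewrite bE size_Mmonic ?monicMl ?monicXsubC //.
  rewrite size_mul ?polyXsubC_eq0 // !size_XsubC /= addn3 /=.
  by rewrite ltnS => /ltnW.
have := bpos _ tR; rewrite bE !hornerM !hornerXsubC.
have -> : (t - l) * (t - l^*) = `|t - l| ^+ 2.
  by rewrite normCK rmorphB /= (conj_Creal tR).
rewrite pmulr_lgt0 // exprn_gt0 // normr_gt0 subr_eq0.
by apply: contra lR => /eqP <-.
Qed.

Definition posdefmx n (H : 'M[C]_n) :=
  forall u : 'rV_n, u != 0 -> 0 < (u *m H *m u ^t*) 0 0.

(** Induction by Schur complement: with b the corner entry, c the rest of its
column and D the complementary block, b D - c c^# is again positive definite
and equals G^# G. This factors b B, and b is then peeled off. *)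
Lemma fejer_riesz n (B : 'M[{poly C}]_n) :
  adjmx B = B -> (forall t, t \is Num.real -> posdefmx (evalmx t B)) ->
  exists E : 'M_n, adjmx E *m E = B.
Proof.
elim: n B => [|n IH] B Ba Bpos; first by exists 0; apply/matrixP; case.
rewrite -[n.+1]/(1 + n)%N in B Ba Bpos *.
pose b := B 0 0; pose c := dlsubmx B; pose D := drsubmx B.
have BE : B = block_mx (b%:M) (adjmx c) c D.
  rewrite -[LHS]submxK; congr block_mx.
    by apply/matrixP => i j; rewrite !mxE !ord1 /= mulr1n; congr (B _ _); apply/val_inj.
  by apply/matrixP => i j; rewrite -{1}Ba !mxE.
have Da : adjmx D = D by rewrite /D -[in RHS]Ba; apply/matrixP => i j; rewrite !mxE.
have ba : polyconj b = b by rewrite /b -[in RHS]Ba !mxE.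
have bpos t : t \is Num.real -> 0 < b.[t].
  move=> tR; have := Bpos t tR (delta_mx 0 0).
  rewrite -rowE trmx_delta map_delta_mx /= -colE !mxE; apply.
  by apply/negP => /eqP/matrixP/(_ 0 0)/eqP; rewrite !mxE /= oner_eq0.
have bC t : t \is Num.real -> (b.[t])^* = b.[t].
  by move=> tR; rewrite conj_Creal // ger0_real // ltW // bpos.
(* At the vector (- u c, b u) the form B takes b times the value of the Schur
   complement at u. *)
have [||G GE] := IH (b *: D - c *m adjmx c).
- have -> (A1 A2 : 'M[{poly C}]_n) : adjmx (A1 - A2) = adjmx A1 - adjmx A2.
    by rewrite /adjmx linearB /= map_mxB.
  by rewrite adjmxZ adjmxM adjmxK Da ba.
- move=> t tR u u0.
  set ct := evalmx t c; set Dt := evalmx t D; set bt := b.[t].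
  have eB : evalmx t B = block_mx bt%:M (ct ^t*) ct Dt.
    rewrite {1}BE /evalmx map_block_mx map_scalar_mx; congr block_mx.
    by rewrite -/(evalmx _ _) evalmx_adjmx conj_Creal.
  have -> : evalmx t (b *: D - c *m adjmx c) = bt *: Dt - ct *m ct ^t*.
    by rewrite /evalmx map_mxB -!/(evalmx _ _) evalmxZ evalmxM evalmx_adjmx conj_Creal.
  have bt0 : bt != 0 by rewrite gt_eqF // bpos.
  have := Bpos t tR (row_mx (- (u *m ct)) (bt *: u)).
  rewrite eB mul_row_block tr_row_mx map_col_mx mul_row_col.
  rewrite mul_mx_scalar scalerN -scalemxAl addNr mul0mx add0r.
  have -> : - (u *m ct) *m ct ^t* + bt *: u *m Dt = u *m (bt *: Dt - ct *m ct ^t*).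
    by rewrite mulNmx addrC mulmxBr mulmxA -scalemxAr -scalemxAl.
  have btC : bt^* = bt by exact: bC.
  rewrite linearZ /= map_mxZ /= btC -scalemxAr.
  have wn0 : row_mx (- (u *m ct)) (bt *: u) != 0.
    apply/negP => /eqP /(congr1 rsubmx); rewrite row_mxKr linear0 => /eqP.
    by rewrite scaler_eq0 (negbTE bt0) (negbTE u0).
  by move=> /(_ wn0); rewrite mxE pmulr_rgt0 ?bpos.
apply: (@peel_positive_factor _ _ b (block_mx b%:M (adjmx c) 0 G)) => //.
have -> : adjmx (block_mx b%:M (adjmx c) 0 G) = block_mx b%:M 0 c (adjmx G).
  by rewrite /adjmx tr_block_mx map_block_mx tr_scalar_mx map_scalar_mx /= ba trmx0 map_mx0 -/(adjmx _) adjmxK.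
rewrite mulmx_block !mul0mx !mulmx0 !addr0 GE BE scale_block_mx.
by rewrite !mul_scalar_mx mul_mx_scalar addrC subrK.
Qed.

(** Sylvester's determinant identity, multiplied by a so as to hold without
dividing. *)
Lemma det_scalar_add_rank1 n (a : {poly C}) (u : 'cV[{poly C}]_n) (v : 'rV_n) :
  a * \det (a%:M + u *m v) = a ^+ n * (a + (v *m u) 0 0).
Proof.
pose M := block_mx (a%:M) (- u) v 1%:M : 'M_(n + 1).
have e1 : M *m block_mx 1%:M 0 (- v) 1%:M = block_mx (a%:M + u *m v) (- u) 0 1%:M.
  rewrite mulmx_block !mulmx1 !mulmx0 !mul1mx mulNmx mulmxN opprK.
  by rewrite add0r addrN add0r.
have e2 : M *m block_mx 1%:M u 0 a%:M = block_mx a%:M 0 v (v *m u + a%:M).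
  rewrite mulmx_block !mulmx1 !mulmx0 !mul1mx !addr0 mul_scalar_mx mul_mx_scalar.
  by rewrite scalerN addrN.
have := congr1 determinant e1; rewrite det_mulmx det_lblock det_ublock !det1 !mulr1 => d1.
have := congr1 determinant e2; rewrite det_mulmx det_ublock det_lblock !det1 mul1r.
rewrite !det_scalar expr1 d1 mulrC => ->; congr (_ * _).
by rewrite det_mx11 !mxE eqxx mulr1n addrC.
Qed.

Lemma unitary_normalize n (w : 'rV[C]_n) : w != 0 ->
  exists u : 'cV_n, w *m u = 1%:M /\ (u *m w) ^t* = u *m w.
Proof.
move=> w0; have d0 := sqnorm_row_gt0 w0; set d := (w *m w ^t*) 0 0 in d0.
have dC : d^* = d by rewrite conj_Creal // ger0_real // ltW.
exists (d^-1 *: w ^t*); split.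
  by rewrite -scalemxAr [w *m _]mx11_scalar -/d scale_scalar_mx mulVf ?gt_eqF.
by rewrite -scalemxAl linearZ /= map_mxZ /= fmorphV /= dC trmx_mul map_mxM trmxCK.
Qed.

(** Left multiplication by the Blaschke-Potapov factor
1 - P + P (X - r^* )/(X - r), unitary on the real line, with P the projector on a
left null vector of E at r: it moves the zero r of the determinant to r^*. *)
Lemma reflect_det_root n (E : 'M[{poly C}]_n) r : root (\det E) r ->
  exists E' : 'M_n, adjmx E' *m E' = adjmx E *m E /\
    ('X - r%:P) * \det E' = ('X - (r^*)%:P) * \det E.
Proof.
rewrite /root -det_evalmx => /det0P[w w0 wE].
have [u [wu uw]] := unitary_normalize w0.
pose wc := map_mx polyC w; pose uc := map_mx polyC u.
have [P Puw] : exists P, P = uc *m wc by exists (uc *m wc).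
have PE0 : P = map_mx polyC (u *m w) by rewrite Puw map_mxM.
have wuc : wc *m uc = 1%:M by rewrite -map_mxM wu map_scalar_mx.
have PP : P *m P = P by rewrite Puw mulmxA -[_ *m wc *m uc]mulmxA wuc mulmx1.
have Pa : adjmx P = P by rewrite PE0 adjmx_polyC uw.
have [U PE] : exists U, P *m E = ('X - r%:P) *: U.
  by apply: evalmx_root; rewrite evalmxM PE0 evalmx_polyC -mulmxA wE mulmx0.
have nz k : 'X - k%:P != 0 :> {poly C} by rewrite polyXsubC_eq0.
have PU : P *m U = U.
  by apply: (scalemx_injr (nz r)); rewrite scalemxAr -PE mulmxA PP.
have Ua : adjmx U *m P = adjmx U by rewrite -[P]adjmxK -adjmxM Pa PU.
pose E' := E - P *m E + ('X - (r^*)%:P) *: U; exists E'; split.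
  have EP : adjmx E *m P = ('X - (r^*)%:P) *: adjmx U.
    by rewrite -polyconj_XsubC -adjmxZ -PE adjmxM Pa.
  have -> : adjmx E' = adjmx E - adjmx E *m P + ('X - r%:P) *: adjmx U.
    rewrite /E' adjmxD adjmxZ polyconj_XsubC conjCK; congr (_ + _).
    by rewrite /adjmx linearB /= map_mxB -/(adjmx _) -/(adjmx (P *m E)) adjmxM Pa.
  have e0 : (adjmx E - adjmx E *m P) *m P = 0.
    by rewrite mulmxBl -mulmxA PP subrr.
  have e1 : P *m (E - P *m E) = 0 by rewrite mulmxBr mulmxA PP subrr.
  rewrite mulmxDl mulmxDr [X in _ + X]mulmxDr -!scalemxAl -!scalemxAr.
  have -> : (adjmx E - adjmx E *m P) *m U = 0 by rewrite -PU mulmxA e0 mul0mx.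
  have -> : adjmx U *m (E - P *m E) = 0 by rewrite -Ua -mulmxA e1 mulmx0.
  rewrite !scaler0 addr0 add0r.
  have -> : ('X - r%:P) *: (('X - (r^*)%:P) *: (adjmx U *m U)) = adjmx E *m P *m (P *m E).
    by rewrite PE EP -scalemxAl -scalemxAr scalerA scalerA mulrC.
  rewrite mulmxBl !mulmxBr !mulmxA.
  by rewrite -!(mulmxA _ P P) PP subrr subr0 subrK.
have XE : ('X - r%:P) *: E' =
    (('X - r%:P)%:M + (((r - r^*)%:P) *: uc) *m wc) *m E.
  rewrite mulmxDl mul_scalar_mx -scalemxAl -scalemxAl -Puw /E' scalerDr scalerBr.
  rewrite -addrA; congr (_ + _); rewrite scalerA mulrC -scalerA -PE -scaleNr -scalerDl.
  by congr (_ *: _); rewrite polyCB; ring.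
have := congr1 determinant XE; rewrite detZ det_mulmx => /(congr1 ( *%R ('X - r%:P))).
rewrite !mulrA det_scalar_add_rank1 -!mulrA mulrCA => /(mulfI (expf_neq0 _ (nz r))) ->.
rewrite -scalemxAr wuc !mxE eqxx; congr (_ * _).
by rewrite mulr1 polyCB; ring.
Qed.

Lemma posdefmx_det_neq0 n (H : 'M[C]_n) : posdefmx H -> \det H != 0.
Proof.
move=> Hp; apply/negP => /det0P[u u0 uH].
by have := Hp u u0; rewrite uH mul0mx mxE ltxx.
Qed.

(** Any factor can be made outer: reflect the zeros of its determinant that lie
in the upper half-plane, one at a time. *)
Lemma fejer_riesz_outer n (B : 'M[{poly C}]_n) :
  adjmx B = B -> (forall t, t \is Num.real -> posdefmx (evalmx t B)) ->
  exists E : 'M_n, adjmx E *m E = B /\ forall l, root (\det E) l -> 'Im l < 0.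
Proof.
move=> Ba Bpos; have [E0 E0B] := fejer_riesz Ba Bpos.
have nreal (E : 'M[{poly C}]_n) l : adjmx E *m E = B -> l \is Num.real ->
    ~~ root (\det E) l.
  move=> EB lR; apply/negP => /eqP l0; have := posdefmx_det_neq0 (Bpos _ lR).
  by rewrite -EB evalmxM det_mulmx !det_evalmx l0 mulr0 eqxx.
have [rs E0rs] := closed_field_poly_normal (\det E0).
have [k] := ubnP (count (fun r => 0 < 'Im r) rs).
elim: k rs E0 E0B E0rs => // k IH rs E EB Ers.
have c0 : lead_coef (\det E) != 0.
  rewrite lead_coef_eq0; apply: contra (nreal E 0 EB (real0 _)) => /eqP ->.
  by rewrite /root horner0.
have [hs|] := boolP (has (fun r => 0 < 'Im r) rs); last first.
  move=> hs _; exists E; split=> // l rl.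
  have lrs : l \in rs by move: rl; rewrite Ers rootZ // root_prod_XsubC.
  rewrite real_ltNge ?Creal_Im ?real0 // le_eqVlt negb_or.
  rewrite (hasPn hs) // andbT eq_sym; apply/negP => /eqP /Creal_ImP lR.
  by have := nreal E l EB lR; rewrite rl.
have [r rrs rI] := hasP hs.
move=> cnt; have rE : root (\det E) r by rewrite Ers rootZ // root_prod_XsubC.
have [E' [E'E dE']] := reflect_det_root rE.
apply: (IH (r^* :: rem r rs) E'); first by rewrite E'E.
  have dE'2 : \det E' = lead_coef (\det E) *: (('X - (r^*)%:P) * \prod_(z <- rem r rs) ('X - z%:P)).
    apply: (mulfI (_ : 'X - r%:P != 0)); first by rewrite polyXsubC_eq0.
    rewrite dE' [in LHS]Ers (big_rem r) //= -!scalerAr; congr (_ *: _).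
    by rewrite mulrCA.
  rewrite [in RHS]dE'2 big_cons lead_coefZ lead_coefM lead_coefXsubC mul1r.
  by rewrite lead_coef_prod_XsubC mulr1.
have := perm_to_rem rrs => /permP /(_ (fun r => 0 < 'Im r)) /=.
rewrite rI => cE; move: cnt; rewrite cE /= Im_conj oppr_gt0.
by rewrite (lt_gtF rI) add0n add1n ltnS.
Qed.
End FejerRiesz.

(** * Bezoutians and Hermite's root criterion *)

Section Bezoutian.

(** Coefficient of x^i w^j in the Bezoutian (f(x) g(w) - g(x) f(w)) / (x - w);
the recursion on i is the relation obtained by clearing the denominator, see
[bezout_kernel]. *)
Fixpoint bezout (R : comNzRingType) (f g : {poly R}) (i j : nat) : R :=
  if i is i'.+1 then bezout f g i' j.+1 + (f`_j.+1 * g`_i - g`_j.+1 * f`_i)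
  else f`_j.+1 * g`_0 - g`_j.+1 * f`_0.

Lemma bezout_map (R S : comNzRingType) (phi : {rmorphism R -> S}) f g i j :
  phi (bezout f g i j) = bezout (map_poly phi f) (map_poly phi g) i j.
Proof.
elim: i j => [|i IH] j /=; rewrite !coef_map.
  by rewrite rmorphB !rmorphM.
by rewrite -IH rmorphD rmorphB !rmorphM.
Qed.

Lemma bezout_kernel (R : comNzRingType) (f g : {poly R}) (K : {poly {poly R}}) :
  ('X - 'X%:P) * K = f^:P * g%:P - g^:P * f%:P -> forall i j, K`_i`_j = bezout f g i j.
Proof.
move=> KE i j; have cK k l : (if k is k'.+1 then K`_k'`_l.+1 else 0) - K`_k`_l
    = f`_k * g`_l.+1 - g`_k * f`_l.+1.
  have := congr1 (fun u : {poly {poly R}} => u`_k`_l.+1) KE.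
  rewrite mulrBl !coefB !coefMC !coefXM !coefCM coefXM !coef_map /= !coefCM => <-.
  by case: k => [|k] //=; rewrite coef0.
elim: i j => [|i IH] j /=.
  by have := cK 0 j; rewrite sub0r => /eqP; rewrite eqr_oppLR => /eqP ->; ring.
have := cK i.+1 j; rewrite IH => /eqP; rewrite subr_eq addrC -subr_eq => /eqP <-.
by ring.
Qed.

Variable C : numClosedFieldType.
Local Open Scope sesquilinear_scope.
Implicit Types (q : {poly C}) (ts : seq {poly C}).

Definition reP q : {poly C} := 2^-1 *: (q + polyconj q).
Definition imP q : {poly C} := (2 * 'i)^-1 *: (q - polyconj q).

(** Spanning of the polynomials of size at most N, phrased dually: the
positivity argument only ever evaluates linear functionals. *)
Definition spanning N ts := forall L : {poly C} -> C,
  (forall k a b, L (k *: a + b) = k * L a + L b) ->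
  (forall t, t \in ts -> L t = 0) -> forall a : {poly C}, (size a <= N)%N -> L a = 0.

Lemma twoi_neq0 : 2 * 'i != 0 :> C.
Proof. by rewrite mulf_neq0 ?neq0Ci ?pnatr_eq0. Qed.

(** For q = (x - r) q1 the Bezoutian of [reP q] and [imP q] splits as
(x - r)(w - r^* ) K1 + (r^* - r)/(2 i) q1^#(x) q1(w), where (r^* - r)/(2 i) = - Im r
is positive. Unfolding this over the roots writes the kernel as a sum of
terms t(x) t^#(w), and the t form a basis because q1^# does not vanish at r. *)
Lemma hermite_kernel (rs : seq C) : (forall r, r \in rs -> 'Im r < 0) ->
  exists ts, let q := \prod_(r <- rs) ('X - r%:P) in
  ('X - 'X%:P) * (\sum_(t <- ts) t^:P * (polyconj t)%:P) =
     (2 * 'i)^-1%:P%:P * ((polyconj q)^:P * q%:P - q^:P * (polyconj q)%:P)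
  /\ spanning (size rs) ts.
Proof.
elim: rs => [|r rs IH] rsI.
  exists [::] => /=; split.
    by rewrite !big_nil [polyconj 1]rmorph1 subrr !mulr0.
  move=> L Ll _ a; rewrite leqn0 size_poly_eq0 => /eqP ->.
  have := Ll (-1) 0 0; rewrite scaler0 addr0 mulN1r => /eqP.
  by rewrite addNr => /eqP.
have [|ts] := IH; first by move=> s srs; apply: rsI; rewrite inE srs orbT.
set q1 := \prod_(r <- rs) ('X - r%:P); move=> [KE tspan].
have rI : 'Im r < 0 by apply: rsI; rewrite inE eqxx.
pose s := sqrtC (- 'Im r).
have sE : s ^+ 2 = (2 * 'i)^-1 * (r^* - r).
  by rewrite sqrtCK ImE invfM invCi; ring.
have sC : s^* = s by rewrite conj_Creal // ger0_real // sqrtC_ge0 oppr_ge0 ltW.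
exists (s *: polyconj q1 :: [seq ('X - r%:P) * t | t <- ts]) => /=.
rewrite !big_cons -/q1; split.
  set S := \sum_(t <- ts) _ in KE.
  have -> : \sum_(t <- [seq ('X - r%:P) * t | t <- ts]) t^:P * (polyconj t)%:P =
      ('X - r%:P%:P) * ('X - (r^*)%:P)%:P * S.
    rewrite big_map mulr_sumr; apply: eq_bigr => t _.
    rewrite [polyconj (_ * _)]rmorphM /= polyconj_XsubC !rmorphM /= rmorphB /=.
    rewrite map_polyX map_polyC /= mulrACA.
    by [].
  have -> : (s *: polyconj q1)^:P * (polyconj (s *: polyconj q1))%:P =
      (2 * 'i)^-1%:P%:P * ((r^*)%:P%:P - r%:P%:P) * (polyconj q1)^:P * q1%:P.
    rewrite -!mul_polyC !rmorphM /= polyconjK [polyconj s%:P]map_polyC /= sC.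
    rewrite map_polyC /= mulrACA -!polyCM -expr2 sE -!polyCB -!polyCM.
    by rewrite !mulrA.
  rewrite [polyconj (_ * _)]rmorphM /= polyconj_XsubC !rmorphM /= !rmorphB /=.
  rewrite !map_polyX !map_polyC /= mulrDr [X in _ + X]mulrCA KE.
  by ring.
move=> L Ll Lts a sa.
have L0 : L 0 = 0.
  by have /eqP := Ll (-1) 0 0; rewrite scaler0 addr0 mulN1r addNr => /eqP.
have LZ k b : L (k *: b) = k * L b by rewrite -[k *: b]addr0 Ll L0 addr0.
have s0 : s != 0 by rewrite sqrtC_eq0 oppr_eq0 lt_eqF.
have Lq1 : L (polyconj q1) = 0.
  have := Lts (s *: polyconj q1); rewrite inE eqxx => /(_ isT) /eqP.
  by rewrite LZ mulf_eq0 (negbTE s0) => /eqP.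
have q1r : (polyconj q1).[r] != 0.
  rewrite horner_polyconj conjC_eq0; apply/negP => q1r.
  have : r^* \in rs by rewrite -root_prod_XsubC.
  move=> rrs; have := rsI r^*; rewrite inE rrs orbT => /(_ isT).
  by rewrite Im_conj oppr_lt0 (lt_gtF rI).
pose k := a.[r] / (polyconj q1).[r].
have : root (a - k *: polyconj q1) r.
  by rewrite /root !hornerE /k divfK // subrr.
move=> /factor_theorem[b bE].
have sq1 : size (polyconj q1) = (size rs).+1.
  by rewrite /polyconj size_map_poly size_prod_XsubC.
have sb : (size b <= size rs)%N.
  have [->|b0] := eqVneq b 0; first by rewrite size_poly0.
  have := congr1 (fun p : {poly C} => size p) bE; rewrite size_Mmonic ?monicXsubC //.
  rewrite size_XsubC addn2 /= => sb; rewrite -ltnS -sb.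
  rewrite (leq_trans (size_polyD _ _)) // geq_max sa size_polyN.
  by rewrite (leq_trans (size_scale_leq _ _)) // sq1.
have -> : a = k *: polyconj q1 + b * ('X - r%:P) by rewrite -bE addrC subrK.
rewrite Ll Lq1 mulr0 add0r.
apply: (tspan (fun b => L (b * ('X - r%:P)))) => //.
  by move=> c u v /=; rewrite mulrDl -scalerAl Ll.
by move=> t tts; apply: Lts; rewrite inE mulrC map_f ?orbT.
Qed.

(** In terms of the polynomials t of [hermite_kernel] the quadratic form is
the sum of the |L t|^2, with L the functional whose coordinates are u. *)
Theorem hermite_criterion N q : q \is monic -> size q = N.+1 ->
  (forall r, root q r -> 'Im r < 0) ->
  (forall i j, (bezout (reP q) (imP q) i j)^* = bezout (reP q) (imP q) j i) /\
  posdefmx (\matrix_(i < N, j < N) bezout (reP q) (imP q) i j).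
Proof.
move=> qmon sq rootq.
have [rs qE] := closed_field_poly_normal q.
rewrite (monicP qmon) scale1r in qE.
have srs : size rs = N by move: sq; rewrite qE size_prod_XsubC => -[].
have [|ts] := @hermite_kernel rs.
  by move=> r rrs; apply: rootq; rewrite qE root_prod_XsubC.
rewrite -qE srs => -[KE tspan].
set K := \sum_(t <- ts) _ in KE.
have bE i j : bezout (reP q) (imP q) i j = K`_i`_j.
  symmetry; apply: bezout_kernel; rewrite KE /reP /imP.
  rewrite -!mul_polyC !rmorphM /= !rmorphD /= !rmorphN /= !map_polyC /=.
  have h : 2^-1%:P%:P * 2 = 1 :> {poly {poly C}}.
    rewrite (_ : 2 = 2%:P%:P) -?polyCM ?mulVf ?pnatr_eq0 //.
    by rewrite !(polyCMn, polyC1).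
  by rewrite -[LHS]mul1r -h; ring.
have KC i j : K`_i`_j = \sum_(t <- ts) t`_i * (t`_j)^*.
  rewrite /K !coef_sum; apply: eq_bigr => t _.
  by rewrite coefMC coef_map /= coefCM coef_map.
split=> [i j|u u0].
  rewrite !bE !KC rmorph_sum; apply: eq_bigr => t _.
  by rewrite rmorphM /= conjCK mulrC.
pose L (a : {poly C}) := \sum_(i < N) u 0 i * a`_i.
have -> : (u *m (\matrix_(i < N, j < N) bezout (reP q) (imP q) i j) *m u ^t*) 0 0 =
    \sum_(t <- ts) L t * (L t)^*.
  rewrite mxE; under eq_bigr => j _.
    rewrite !mxE mulr_suml; under eq_bigr => i _.
      rewrite !mxE bE KC mulr_sumr mulr_suml; over.
    rewrite exchange_big /=; over.
  rewrite exchange_big /=; apply: eq_bigr => t _.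
  rewrite /L rmorph_sum mulr_suml exchange_big; apply: eq_bigr => i _.
  rewrite mulr_sumr; apply: eq_bigr => j _; rewrite rmorphM; ring.
have Lge t : 0 <= L t * (L t)^* by rewrite mul_conjC_ge0.
rewrite lt_def sumr_ge0 // andbT; apply: contra u0.
rewrite psumr_eq0 // => /allP Lt0.
apply/eqP/rowP => i; rewrite !mxE.
have <- : L 'X^i = u 0 i.
  rewrite /L (bigD1 i) //= coefXn eqxx mulr1 big1 ?addr0 // => j ji.
  by rewrite coefXn (_ : _ == _ = false) ?mulr0 //; apply/negbTE.
apply: tspan => [k a b|t tts|]; last by rewrite size_polyXn ltn_ord.
  rewrite /L mulr_sumr -big_split /=; apply: eq_bigr => j _.
  by rewrite coefD coefZ; ring.
by apply/eqP; rewrite -mul_conjC_eq0; apply: Lt0.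
Qed.
End Bezoutian.

(** * Companion matrices symmetrized by the Bezoutian *)

Section Companion.
Variable R : comNzRingType.

(** [companionmx] with its size kept as a parameter instead of being computed
from p, so that matrices attached to different polynomials have one type. *)
Definition compmx n (p : {poly R}) : 'M[R]_n.+1 :=
  \matrix_(i, j) if i == n :> nat then - p`_j else (i.+1 == j)%:R.

Lemma char_poly_compmx n (p : {poly R}) : p \is monic -> size p = n.+2 ->
  char_poly (compmx n p) = p.
Proof.
move=> pm sp; rewrite -[RHS](companionmxK pm) /companionmx sp /=.
by congr char_poly; apply/matrixP => i j; rewrite !mxE.
Qed.

Lemma bezout_oversize (f g : {poly R}) i j :
  (size f <= j.+1)%N -> (size g <= j.+1)%N -> bezout f g i j = 0.
Proof.
elim: i j => [|i IH] j sf sg /=; rewrite ![_`_j.+1]nth_default // !mul0r subrr //.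
by rewrite addr0 IH // ltnW.
Qed.

Lemma bezout_last n (f g : {poly R}) i : f \is monic -> size f = n.+2 ->
  (size g <= n.+1)%N -> bezout f g i n = g`_i.
Proof.
move=> fm sf sg.
have f1 : f`_n.+1 = 1 by move/monicP: fm; rewrite /lead_coef sf.
have g0 : g`_n.+1 = 0 by rewrite nth_default.
case: i => [|i] /=; rewrite f1 g0 mul1r mul0r subr0 //.
by rewrite bezout_oversize ?add0r ?sf // ltnW.
Qed.

(** With f and g real on the real line and the Bezoutian Hermitian, the
recursion defining [bezout] turns this formula into its own adjoint: the
Bezoutian symmetrizes the companion matrix of f. *)
Lemma mul_bezout_compmx n (f g : {poly R}) i j :
  f \is monic -> size f = n.+2 -> (size g <= n.+1)%N ->
  ((\matrix_(i < n.+1, j < n.+1) bezout f g i j) *m compmx n f) i j =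
  (if (j : nat) is j'.+1 then bezout f g i j' else 0) - g`_i * f`_j.
Proof.
move=> fm sf sg; rewrite !mxE big_ord_recr /= !mxE eqxx bezout_last // mulrN; congr (_ - _).
under eq_bigr => k _ do rewrite !mxE /= ltn_eqF ?ltn_ord //.
case: j => -[|j] jn /=.
  by rewrite big1 // => k _; rewrite mulr0.
rewrite (bigD1 (Ordinal (jn : (j < n)%N))) //= eqxx mulr1 big1 ?addr0 // => k kj.
rewrite eqSS (_ : (k == j :> nat) = false) ?mulr0 //.
by apply/negbTE; apply: contra kj => /eqP kj; apply/eqP/val_inj.
Qed.
End Companion.

Section PolyConj.
Variable C : numClosedFieldType.

(** Top coefficients cannot cancel, being squared moduli. The sum has even degree,
so the bound on its size may be relaxed by one. *)
Lemma size_sum_polyconj (I : finType) (p : I -> {poly C}) s :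
  (size (\sum_k polyconj (p k) * p k)%R <= (s.*2).+2)%N -> forall k, (size (p k) <= s.+1)%N.
Proof.
move=> ssum; pose e := \max_k size (p k).
have pe k : (size (p k) <= e)%N by apply: leq_bigmax.
have [es k|es] := leqP e s.+1; first exact: leq_trans (pe k) es.
have [e' eE] : exists e', e = e'.+1 by case: e es {pe} => // e'; exists e'.
rewrite eE in pe es *.
have cE k : (polyconj (p k) * p k)`_(e' + e') = `|(p k)`_e'| ^+ 2.
  rewrite coefM (bigD1 (Ordinal (leq_addr e' e'.+1 : (e' < (e' + e').+1)%N))) //=.
  rewrite addnK coef_map /= big1 ?addr0; first by rewrite normCK mulrC.
  move=> i ie; have [ilt|igt] := ltnP i e'.
    by rewrite [(p k)`__]nth_default ?mulr0 // (leq_trans (pe k)) //; lia.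
  have ie' : (e' < i)%N by rewrite ltn_neqAle igt andbT eq_sym; apply: contra ie => /eqP ie; apply/eqP/val_inj.
  by rewrite coef_map /= [(p k)`_i]nth_default ?rmorph0 ?mul0r // (leq_trans (pe k)).
have := @nth_default _ 0 _ (e' + e')%N (leq_trans ssum (_ : (_ <= e' + e')%N)).
rewrite coef_sum => sum0.
have {}sum0 : \sum_k `|(p k)`_e'| ^+ 2 = 0.
  apply: etrans (sum0 _); last by lia.
  by apply: eq_bigr => k _; rewrite cE.
have pe0 k : (p k)`_e' = 0.
  move/eqP: sum0; rewrite psumr_eq0 => [/allP/(_ k (mem_index_enum _))|i _]; last exact: exprn_ge0.
  by rewrite /= sqrf_eq0 normr_eq0 => /eqP.
have : (e <= e')%N.
  apply/bigmax_leqP => k _; apply/leq_sizeP => j; rewrite leq_eqVlt => /orP[/eqP <- //|ej].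
  by rewrite nth_default // (leq_trans (pe k)).
by rewrite eE ltnn.
Qed.

End PolyConj.

(** * Determinantal representation *)

Section Representation.
Local Open Scope sesquilinear_scope.
Variable C : numClosedFieldType.

Lemma adjmx_adjugate n (A : 'M[{poly C}]_n) : adjmx (\adj A) = \adj (adjmx A).
Proof. by rewrite /adjmx trmx_adj map_mx_adj /=. Qed.

(** M = E T E^-1 is L / d with d = det E and L = E T adj E. The hypothesis gives
d^# L = d L^#, and d is coprime to d^# because their roots lie in opposite
half-planes; hence d divides L. *)
Lemma selfadjoint_conjugate n (E T : 'M[{poly C}]_n.+1) :
  (forall l, root (\det E) l -> 'Im l < 0) ->
  adjmx (adjmx E *m E *m T) = adjmx E *m E *m T ->
  exists M : 'M_n.+1, [/\ adjmx M = M, E *m T = M *m E & \tr (M *m M) = \tr (T *m T)].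
Proof.
move=> Eroot ETa; pose d := \det E.
have [L LE] : exists L, L = E *m T *m \adj E by exists (E *m T *m \adj E).
have d0 : d != 0.
  apply/negP => /eqP d0; have := Eroot 0; rewrite -/d d0 /root horner0 eqxx.
  by move=> /(_ isT); rewrite (Creal_ImP _ (real0 _)) ltxx.
have dc0 : polyconj d != 0 by rewrite -(inj_eq (inv_inj (@polyconjK C))) polyconjK rmorph0.
have cop : coprimep d (polyconj d).
  apply: Pdiv.ClosedField.root_coprimep => l rl; rewrite horner_polyconj conjC_eq0.
  apply/negP => rlc; have := Eroot l^* rlc; rewrite Im_conj oppr_lt0.
  by rewrite (lt_gtF (Eroot l rl)).
have LL : polyconj d *: L = d *: adjmx L.
  have adjE : \adj (adjmx E) *m adjmx E = (polyconj d)%:M.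
    by rewrite mul_adj_mx det_adjmx.
  rewrite LE adjmxM adjmx_adjugate adjmxM -mul_scalar_mx -adjE.
  rewrite -!mulmxA; rewrite -mul_mx_scalar -!mulmxA; congr (_ *m _).
  have -> : adjmx E *m (E *m (T *m \adj E)) = adjmx (adjmx E *m E *m T) *m \adj E.
    by rewrite ETa !mulmxA.
  by rewrite !adjmxM adjmxK -!mulmxA mul_mx_adj.
have dL i j : d %| L i j.
  rewrite -(Gauss_dvdpr _ cop); move/matrixP/(_ i j): LL; rewrite !mxE => ->.
  exact: dvdp_mulr.
pose M := \matrix_(i, j) (L i j %/ d).
have LM : L = d *: M by apply/matrixP => i j; rewrite !mxE mulrC divpK //.
have EM : E *m T = M *m E.
  apply: (scalemx_injr d0); rewrite [RHS]scalemxAl -LM LE -!mulmxA mul_adj_mx.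
  by rewrite mul_mx_scalar -scalemxAr.
exists M; split=> //.
  apply: (scalemx_injr (mulf_neq0 d0 dc0)).
  by rewrite -scalerA -adjmxZ -LM -LL LM scalerA mulrC.
apply: (mulfI d0); rewrite -!mxtraceZ [in LHS]scalemxAl -LM LE.
rewrite -!mulmxA mxtrace_mulC -!mulmxA -EM [\adj E *m _]mulmxA mul_adj_mx.
by rewrite mul_scalar_mx -scalemxAr.
Qed.


(** Only the last row of a companion matrix is not constant, so the trace of its
square is F_(m+1)^2 - 2 F_m. *)
Lemma size_compmx_sq m (F : {poly {poly C}}) :
  (size (F`_m.+1)%R <= 2)%N -> (size (F`_m)%R <= 3)%N ->
  (size (\tr (compmx m.+1 F *m compmx m.+1 F))%R <= 3)%N.
Proof.
move=> F1 F0; apply: (leq_trans (size_sum _ _ _)); apply/bigmax_leqP => i _.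
rewrite !mxE; apply: (leq_trans (size_sum _ _ _)); apply/bigmax_leqP => k _.
rewrite !mxE; have szn (b : bool) : (size (b%:R : {poly C})%R <= 1)%N.
  by case: b; rewrite ?size_poly1 ?size_poly0.
have szM (p q : {poly C}) a b : (size p <= a.+1)%N -> (size q <= b.+1)%N ->
    (size (p * q)%R <= (a + b).+1)%N.
  by move=> sp sq; apply: leq_trans (size_polyMleq _ _) _; lia.
case: (i =P m.+1 :> nat) => ie; case: (k =P m.+1 :> nat) => ke.
- by apply: (szM _ _ 1 1); rewrite size_polyN ?ke ?ie.
- case: eqP => [ki|_]; last by rewrite mulr0 size_poly0.
  have -> : (k : nat) = m by move: ki; rewrite ie => -[].
  by rewrite mulr1 size_polyN.
- case: eqP => [ki|_]; last by rewrite mul0r size_poly0.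
  have -> : (i : nat) = m by move: ki; rewrite ke => -[].
  by rewrite mul1r size_polyN.
- by apply: (leq_trans (szM _ _ 0 0 _ _)); rewrite ?szn.
Qed.

Lemma polyconj_map_eval t (Q : {poly {poly C}}) : t \is Num.real ->
  map_poly (horner_eval t) (map_poly (@polyconj C) Q) = polyconj (map_poly (horner_eval t) Q).
Proof.
move=> tR; apply/polyP => i; rewrite !coef_map /= /horner_eval.
by rewrite horner_polyconj (conj_Creal tR).
Qed.

Lemma char_poly_intertwined (R : idomainType) n (E S T : 'M[R]_n) :
  \det E != 0 -> E *m S = T *m E -> char_poly S = char_poly T.
Proof.
move=> d0 ES; have dc0 : (\det E)%:P != 0 by rewrite polyC_eq0.
have EX : map_mx polyC E *m char_poly_mx S = char_poly_mx T *m map_mx polyC E.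
  by rewrite /char_poly_mx mulmxBl mulmxBr -!map_mxM ES scalar_mxC.
have := congr1 determinant EX; rewrite !det_mulmx [\det (map_mx _ _)]det_map_mx.
by rewrite mulrC => /(mulIf dc0).
Qed.

(** Rows and columns are indexed by the powers of x. The bounds on the two
subleading coefficients are what a total degree m + 2 would give; they make
M of degree at most 1 and v constant. *)
Theorem determinantal_representation m (Q : {poly {poly C}}) :
  Q \is monic -> size Q = m.+3 -> (size (Q`_m.+1)%R <= 2)%N -> (size (Q`_m)%R <= 3)%N ->
  (forall t r, t \is Num.real -> root (map_poly (horner_eval t) Q) r -> 'Im r < 0) ->
  exists A D : 'M[C]_m.+2, exists v : 'cV[C]_m.+2,
   [/\ A ^t* = A, D ^t* = D &
    forall x y, \det (x%:M - A - y *: D + 'i *: (v *m v ^t*)) = Q.[x%:P].[y]].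
Proof.
move=> Qm sQ Q1 Q0 Qroot; pose Qc := map_poly (@polyconj C) Q.
pose F : {poly {poly C}} := (2^-1)%:P *: (Q + Qc).
pose G : {poly {poly C}} := ((2 * 'i)^-1)%:P *: (Q - Qc).
have iF i : F`_i = 2^-1 *: (Q`_i + polyconj Q`_i) by rewrite coefZ coefD coef_map mul_polyC.
have iG i : G`_i = (2 * 'i)^-1 *: (Q`_i - polyconj Q`_i) by rewrite coefZ coefB coef_map mul_polyC.
have cjZ k (p : {poly C}) : polyconj (k *: p) = k^* *: polyconj p by rewrite /polyconj map_polyZ.
have Fc i : polyconj F`_i = F`_i.
  by rewrite iF cjZ rmorphD /= polyconjK addrC conj_Creal // rpredV realn.
have Gc i : polyconj G`_i = G`_i.
  rewrite iG cjZ rmorphB /= polyconjK -opprB scalerN -scaleNr; congr (_ *: _).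
  by rewrite fmorphV rmorphM /= conjCi (conj_Creal (realn _ _)) mulrN invrN opprK.
(* Q = F + i G, with F monic and G of smaller degree in x. *)
have QFG i : Q`_i = F`_i + 'i *: G`_i.
  have tw := @twoi_neq0 C; rewrite iF iG scalerA.
  have -> : 'i * (2 * 'i)^-1 = 2^-1 :> C by rewrite invfM mulrCA mulfV ?neq0Ci // mulr1.
  by rewrite -scalerDr addrACA subrr addr0 -mulr2n -scaler_nat scalerA mulVf ?scale1r // pnatr_eq0.
have szF i s : (size (Q`_i)%R <= s)%N -> (size (F`_i)%R <= s)%N.
  move=> sQi; rewrite iF (leq_trans (size_scale_leq _ _)) //.
  by rewrite (leq_trans (size_polyD _ _)) // geq_max sQi size_map_poly.
have szG i s : (size (Q`_i)%R <= s)%N -> (size (G`_i)%R <= s)%N.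
  move=> sQi; rewrite iG (leq_trans (size_scale_leq _ _)) //.
  by rewrite (leq_trans (size_polyD _ _)) // geq_max sQi size_polyN size_map_poly.
have Qlead : Q`_m.+2 = 1 by move/monicP: Qm; rewrite /lead_coef sQ.
have F1 : F`_m.+2 = 1.
  by rewrite iF Qlead rmorph1 -mulr2n -scaler_nat scalerA mulVf ?scale1r // pnatr_eq0.
have sF : size F = m.+3.
  apply/eqP; rewrite eqn_leq; apply/andP; split.
    apply/leq_sizeP => j mj; rewrite iF nth_default ?sQ //.
    by rewrite rmorph0 addr0 scaler0.
  by rewrite ltnNge; apply/negP => /leq_sizeP/(_ m.+2 (leqnn _))/eqP; rewrite F1 oner_eq0.
have Fm : F \is monic by rewrite monicE /lead_coef sF F1.
have sG : (size G <= m.+2)%N.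
  apply/leq_sizeP => j; rewrite leq_eqVlt => /orP[/eqP <-|mj].
    by rewrite iG Qlead rmorph1 subrr scaler0.
  by rewrite iG nth_default ?sQ // rmorph0 subrr scaler0.
pose B : 'M[{poly C}]_m.+2 := \matrix_(i, j) bezout F G i j.
have bt t i j : t \is Num.real -> (bezout F G i j).[t] =
    bezout (reP (map_poly (horner_eval t) Q)) (imP (map_poly (horner_eval t) Q)) i j.
  move=> tR; rewrite -[LHS]/(horner_eval t _) bezout_map /reP /imP -!polyconj_map_eval //.
  congr bezout.
    by rewrite map_polyZ /= rmorphD /= /horner_eval hornerC.
  by rewrite map_polyZ /= rmorphB /= /horner_eval hornerC.
have Qtm t : map_poly (horner_eval t) Q \is monic by exact: monic_map.
have sQt t : size (map_poly (horner_eval t) Q) = m.+3.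
  by rewrite size_map_poly_id0 // (monicP Qm) /horner_eval hornerC oner_neq0.
have hc t (tR : t \is Num.real) :=
  @hermite_criterion C m.+2 _ (Qtm t) (sQt t) (fun r => Qroot t r tR).
have Bherm i j : polyconj (bezout F G i j) = bezout F G j i.
  apply: eq_poly_real => t tR; rewrite horner_polyconj (conj_Creal tR) !bt //.
  by have [->] := hc t tR.
have Ba : adjmx B = B by apply/matrixP => i j; rewrite !mxE Bherm.
have Bpos t : t \is Num.real -> posdefmx (evalmx t B).
  move=> tR; have [_] := hc t tR; congr posdefmx.
  by apply/matrixP => i j; rewrite !mxE /horner_eval bt.
have [E [EB Eroot]] := fejer_riesz_outer Ba Bpos.
pose T := compmx m.+1 F.
have BT i j : (B *m T) i j =
    (if (j : nat) is j'.+1 then bezout F G i j' else 0) - G`_i * F`_j.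
  exact: mul_bezout_compmx.
have BTa : adjmx (adjmx E *m E *m T) = adjmx E *m E *m T.
  rewrite EB; apply/matrixP => i j; rewrite [LHS]mxE [X in polyconj X]mxE !BT rmorphB rmorphM /= Fc Gc.
  case: i j => [[|i] im] [[|j] jm]; rewrite ?rmorph0 //.
  - by rewrite /=; ring.
  - by rewrite /= rmorphB !rmorphM /= !Fc !Gc; ring.
  - by rewrite Bherm /=; ring.
have [M [Ma EM trM]] := selfadjoint_conjugate Eroot BTa.
have szM i j : (size (M i j) <= 2)%N.
  have := @size_sum_polyconj C _ (fun ij : 'I_m.+2 * 'I_m.+2 => M ij.1 ij.2) 1.
  have -> : \sum_k polyconj (M k.1 k.2) * M k.1 k.2 = \tr (M *m M).
    rewrite -(pair_bigA _ (fun i j => polyconj (M i j) * M i j)) /= exchange_big.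
    apply: eq_bigr => k _; rewrite mxE; apply: eq_bigr => l _.
    by rewrite -{1}Ma !mxE polyconjK.
  move=> /(_ _ (i, j)); apply; rewrite trM.
  by apply: leq_trans (size_compmx_sq (szF _ _ Q1) (szF _ _ Q0)) _.
(* The last row of the Bezoutian is the coefficient row of G, as F is monic. *)
have Bmax j : B ord_max j = G`_j.
  by rewrite mxE -Bherm bezout_last // Gc.
have [v vE] : exists v, v = col ord_max E by exists (col ord_max E).
have vEE : adjmx v *m E = \row_j G`_j.
  apply/matrixP => i j; rewrite ord1 [RHS]mxE -Bmax -EB vE !mxE.
  by apply: eq_bigr => k _; rewrite !mxE.
have szv i : (size (v i 0%R) <= 1)%N.
  have := @size_sum_polyconj C _ (fun k => v k 0) 0; apply.
  have -> : \sum_k polyconj (v k 0) * v k 0 = (adjmx v *m E) 0 ord_max.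
    by rewrite mxE; apply: eq_bigr => k _; rewrite vE !mxE.
  by rewrite vEE mxE szG.
pose A := map_mx (fun p : {poly C} => p`_0) M.
pose D := map_mx (fun p : {poly C} => p`_1) M.
pose v0 := map_mx (fun p : {poly C} => p`_0) v.
have v0E : v = map_mx polyC v0.
  by apply/matrixP => i j; rewrite [RHS]mxE [X in X%:P]mxE [j]ord1; apply: size1_polyC.
have ME : M = map_mx polyC A + 'X *: map_mx polyC D.
  apply/matrixP => i j; rewrite !mxE; apply/polyP => k.
  rewrite coefD coefC coefXM coefC; case: k => [|[|k]] /=; rewrite ?addr0 ?add0r //.
  by rewrite nth_default // (leq_trans (szM i j)).
have Mc i j k : ((M i j)`_k)^* = (M j i)`_k.
  by rewrite -{2}Ma !mxE coef_map.
exists A, D, v0; split.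
- by apply/matrixP => i j; rewrite !mxE Mc.
- by apply/matrixP => i j; rewrite !mxE Mc.
move=> x y.
pose M' := M - 'i%:P *: (v *m adjmx v).
(* The companion matrices of Q and F differ in their last row only, by i times
   the coefficients of G, that is by i times the last row of E^# E. *)
have EQ : E *m compmx m.+1 Q = M' *m E.
  rewrite mulmxBl -EM -scalemxAl -mulmxA vEE vE.
  apply/matrixP => i j; rewrite [RHS]mxE [LHS]mxE [X in _ = X + _]mxE.
  rewrite big_ord_recr [X in _ = X + _]big_ord_recr /= -addrA; congr (_ + _).
    by apply: eq_bigr => k _; rewrite !mxE /= ltn_eqF ?ltn_ord //.
  by rewrite !mxE big_ord1 !mxE eqxx QFG -mul_polyC; ring.
have cp : char_poly M' = Q.
  rewrite -[RHS](char_poly_compmx Qm sQ); symmetry; apply: char_poly_intertwined EQ.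
  apply/eqP => d0; have := Eroot 0.
  by rewrite d0 /root horner0 eqxx => /(_ isT); rewrite (Creal_ImP _ (real0 _)) ltxx.
have M'y i j : (M' i j).[y] = A i j + y * D i j - 'i * (v0 i 0 * (v0 j 0)^*).
  have -> : M' i j = M i j - 'i%:P * (v i 0 * polyconj (v j 0)).
    by rewrite mxE [X in _ + X]mxE [X in - X]mxE [X in _ * X]mxE big_ord1 [adjmx v _ _]mxE [X in polyconj X]mxE.
  have -> : M i j = (A i j)%:P + 'X * (D i j)%:P by rewrite ME !mxE.
  have vk k : v k 0 = (v0 k 0)%:P by rewrite v0E mxE.
  by rewrite !vk /polyconj map_polyC !hornerE.
have -> : Q.[x%:P].[y] = \det (map_mx (fun p : {poly {poly C}} => p.[x%:P].[y]) (char_poly_mx M')).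
  rewrite -[in LHS]cp /char_poly -[LHS]/((horner_eval y \o horner_eval x%:P) _).
  by rewrite -det_map_mx.
congr determinant; apply/matrixP => i j; rewrite [RHS]mxE /char_poly_mx.
rewrite [X in X.[_].[_]]mxE [X in (_ + X).[_].[_]]mxE [X in (_ + - X).[_].[_]]mxE.
rewrite hornerD hornerN hornerC hornerD hornerN M'y.
have -> : ('X%:M : 'M[{poly {poly C}}]_m.+2) i j = 'X *+ (i == j) by rewrite mxE.
rewrite hornerMn hornerX hornerMn hornerC.
rewrite !mxE big_ord1 !mxE; ring.
Qed.

End Representation.

(** * Total degree of bivariate polynomials *)

Section TotalDegree.
Variable C : numClosedFieldType.

Definition total_degree_le N (Q : {poly {poly C}}) :=
  forall i, (size (Q`_i)%R <= N.+1 - i)%N.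

Lemma total_degree_leW N1 N2 Q : (N1 <= N2)%N ->
  total_degree_le N1 Q -> total_degree_le N2 Q.
Proof. by move=> N12 dQ i; apply: leq_trans (dQ i) _; apply: leq_sub2r. Qed.

Lemma total_degree_le_sum N (I : Type) (s : seq I) (P : pred I) (Q : I -> {poly {poly C}}) :
  (forall i, P i -> total_degree_le N (Q i)) ->
  total_degree_le N (\sum_(i <- s | P i) Q i).
Proof.
move=> dQ i; rewrite coef_sum; apply: (big_ind (fun p : {poly C} => (size p <= N.+1 - i)%N)).
- by rewrite size_poly0.
- by move=> p q sp sq; rewrite (leq_trans (size_polyD _ _)) // geq_max sp.
- by move=> j Pj; apply: dQ.
Qed.

Lemma total_degree_leM N1 N2 Q1 Q2 : total_degree_le N1 Q1 ->
  total_degree_le N2 Q2 -> total_degree_le (N1 + N2) (Q1 * Q2).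
Proof.
move=> d1 d2 i; rewrite coefM; apply: (leq_trans (size_sum _ _ _)).
apply/bigmax_leqP => -[j /= ji] _; move: (d1 j) (d2 (i - j)%N).
have [->|p0] := eqVneq Q1`_j 0; first by rewrite mul0r size_poly0.
have [->|q0] := eqVneq Q2`_(i - j) 0; first by rewrite mulr0 size_poly0.
rewrite size_mul //; move: p0 q0; rewrite -!size_poly_gt0.
by move: (size Q1`_j) (size Q2`_(i - j)) => a b; move: ji; clear; lia.
Qed.

Lemma total_degree_le_exp N Q k : total_degree_le N Q -> total_degree_le (k * N) (Q ^+ k).
Proof.
move=> dQ; elim: k => [|k IH].
  rewrite expr0 => -[|i]; first by rewrite coef1 size_poly1.
  by rewrite coef1 size_poly0.
by rewrite exprS mulSn; apply: total_degree_leM.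
Qed.

Lemma total_degree_le_const c : total_degree_le 0 c%:P%:P.
Proof.
by move=> [|i]; rewrite coefC /= ?size_poly0 // size_polyC leq_b1.
Qed.

Lemma total_degree_le_linear (c : C) : total_degree_le 1 ('X + (c *: 'X)%:P).
Proof.
move=> [|[|i]]; rewrite coefD coefX coefC /= ?add0r ?addr0 ?size_poly0 ?size_poly1 //.
by rewrite (leq_trans (size_scale_leq _ _)) // size_polyX.
Qed.

Lemma total_degree_le_size N Q : total_degree_le N Q -> (size Q <= N.+1)%N.
Proof.
move=> dQ; apply/leq_sizeP => j jN; apply/eqP; rewrite -size_poly_eq0.
by rewrite -leqn0 (leq_trans (dQ j)) //; lia.
Qed.

End TotalDegree.


(** * Eigenvalues and the Frobenius norm *)

Section Schur.
Local Open Scope sesquilinear_scope.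
Variable C : numClosedFieldType.

(** The l are the diagonal of a triangular matrix unitarily similar to W. *)
Lemma schur_eigenvalues n (W : 'M[C]_n.+1) : exists l : 'I_n.+1 -> C,
  [/\ forall t, \det (1%:M + t *: W) = \prod_i (1 + t * l i),
      \sum_i l i = \tr W, \sum_i l i ^+ 2 = \tr (W *m W) &
      \sum_i `|l i| ^+ 2 <= \tr (W *m W ^t*)].
Proof.
have [P Pu] := Schur W (ltn0Sn n); rewrite /similar_to conjymx // => Dt.
have PP : P *m P ^t* = 1%:M by apply/unitarymxP.
have PP' : P ^t* *m P = 1%:M by rewrite -invmx_unitary // mulVmx ?unitarymx_unit.
have [D DE] : exists D, D = P *m W *m P ^t* by exists (P *m W *m P ^t*).
rewrite -DE in Dt.
have WE : W = P ^t* *m D *m P by rewrite DE -!mulmxA PP' mulmx1 mulmxA PP' mul1mx.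
have trig A : \tr (P ^t* *m A *m P) = \tr A by rewrite mxtrace_mulC mulmxA PP mul1mx.
have Dtr (i j : 'I_n.+1) : (i < j)%N -> D i j = 0 by move: Dt => /is_trig_mxP; apply.
exists (fun i => D i i); split.
- move=> t; have -> : 1%:M + t *: W = P ^t* *m (1%:M + t *: D) *m P.
    by rewrite mulmxDr mulmx1 mulmxDl PP' -scalemxAr -scalemxAl -WE.
  rewrite -[\det _]/(\det _) !det_mulmx mulrAC -det_mulmx PP' det1 mul1r det_trig.
    by apply: eq_bigr => i _; rewrite !mxE eqxx mulr1n.
  apply/is_trig_mxP => i j ij; rewrite !mxE Dtr // mulr0 addr0.
  by rewrite -val_eqE /= ltn_eqF.
- by rewrite WE trig.
- rewrite WE -!mulmxA [P *m (P ^t* *m _)]mulmxA PP mul1mx !mulmxA -[P ^t* *m D *m D]mulmxA trig.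
  apply: eq_bigr => i _; rewrite mxE (bigD1 i) //= -expr2 big1 ?addr0 // => k ki.
  by have [ik|ik|/val_inj ik] := ltngtP i k; rewrite ?(Dtr _ _ ik) ?mul0r ?mulr0 //; rewrite ik eqxx in ki.
rewrite {1}WE.
have -> : W ^t* = P ^t* *m D ^t* *m P.
  by rewrite WE !trmx_mul !map_mxM trmxCK mulmxA.
rewrite -!mulmxA [P *m (P ^t* *m _)]mulmxA PP mul1mx !mulmxA -[P ^t* *m D *m D ^t*]mulmxA trig.
apply: ler_sum => i _; rewrite mxE (bigD1 i) //= !mxE -normCK lerDl.
by apply: sumr_ge0 => k _; rewrite !mxE -normCK exprn_ge0.
Qed.

(** H^k H^k = H^(k+1) H^(k-1) = 0 gives H^k = 0 by positivity, which lowers the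
exponent down to 1. *)
Lemma hermitian_nilpotent n (H : 'M[C]_n.+1) k : H ^t* = H -> H ^+ k = 0 -> H = 0.
Proof.
move=> Hh; have sq0 (A : 'M[C]_n.+1) : A *m A ^t* = 0 -> A = 0.
  move=> AA; apply/row_matrixP => i; rewrite row0; apply/eqP/negPn/negP => /sqnorm_row_gt0.
  have -> : (row i A *m (row i A) ^t*) 0 0 = (A *m A ^t*) i i.
    by rewrite !mxE; apply: eq_bigr => j _; rewrite !mxE.
  by rewrite AA mxE ltxx.
have Hk j : (H ^+ j) ^t* = H ^+ j.
  elim: j => [|j IH]; first by rewrite expr0 trmx1 map_mx1.
  by rewrite [in LHS]exprSr -[_ * _]/(_ *m _) trmx_mul map_mxM Hh IH exprS.
elim: k => [|k IH].
  by move=> /(congr1 ( *%R H)); rewrite expr0 mulr1 mulr0.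
have [->|k0] := posnP k; first by rewrite expr1.
move=> Hk0; apply: IH; apply: sq0; rewrite Hk -[_ *m _]/(_ * _) -exprD.
by rewrite (_ : (k + k = k.+1 + k.-1)%N) ?exprD ?Hk0 ?mul0r //; lia.
Qed.
End Schur.

(** * Strictly stable polynomials of full bidegree *)

Section StrictlyStable.
Local Open Scope sesquilinear_scope.
Variable C : numClosedFieldType.

Definition bival (a : nat -> nat -> C) n (z1 z2 : C) : C :=
  \sum_(j < n.+1) \sum_(k < n.+1) a j k * (z1 ^+ j * z2 ^+ k).

Definition shear (c : C) : {poly {poly C}} := 'X + (c *: 'X)%:P.

(** The polynomial p(x - y, x + y) / a_nn in the variable x over polynomials in
y. Dividing by the coefficient of z1^n z2^n makes it monic in x. *)
Definition sheared (a : nat -> nat -> C) n : {poly {poly C}} :=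
  \sum_(j < n.+1) \sum_(k < n.+1)
     (a j k / a n n)%:P%:P * (shear (-1) ^+ j * shear 1 ^+ k).

Lemma shear_eval c x y : (shear c).[x%:P].[y] = x + c * y.
Proof. by rewrite /shear !hornerE. Qed.

Lemma sheared_eval a n x y :
  (sheared a n).[x%:P].[y] = bival a n (x - y) (x + y) / a n n.
Proof.
rewrite /sheared /bival horner_sum -[LHS]/(horner_eval y _) rmorph_sum mulr_suml.
apply: eq_bigr => j _; rewrite horner_sum rmorph_sum mulr_suml; apply: eq_bigr => k _.
rewrite /= /horner_eval !(hornerM, hornerC, horner_exp) !shear_eval.
by rewrite mulN1r mul1r mulrAC.
Qed.

Lemma sheared_degree a n : total_degree_le (n.+1 + n.+1) (sheared a n.+1) /\
  (a n.+1 n.+1 != 0 -> sheared a n.+1 \is monic /\ size (sheared a n.+1) = (n + n).+3).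
Proof.
pose term j k : {poly {poly C}} :=
  (a j k / a n.+1 n.+1)%:P%:P * (shear (-1) ^+ j * shear 1 ^+ k).
have dterm j k : total_degree_le (j + k) (term j k).
  rewrite -(add0n (j + k)%N); apply: total_degree_leM; first exact: total_degree_le_const.
  have dexp c i : total_degree_le i (shear c ^+ i).
    by rewrite -{1}(muln1 i); apply: total_degree_le_exp; apply: total_degree_le_linear.
  by apply: total_degree_leM.
(* Only the term (x - y)^(n+1) (x + y)^(n+1) reaches the top degree. *)
have [rest [drest sE]] : exists rest, total_degree_le (n.+1 + n) rest /\
    sheared a n.+1 = rest + term n.+1 n.+1.
  rewrite /sheared big_ord_recr /= [X in _ + X]big_ord_recr /= addrA.
  eexists; split; last by []; move=> i; rewrite coefD.
  rewrite (leq_trans (size_polyD _ _)) // geq_max; apply/andP; split.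
    apply: total_degree_le_sum => j _; apply: total_degree_le_sum => k _.
    by apply: total_degree_leW (dterm _ _); have := ltn_ord k; have := ltn_ord j; lia.
  apply: total_degree_le_sum => k _.
  by apply: total_degree_leW (dterm _ _); have := ltn_ord k; lia.
split=> [i|an0].
  rewrite sE coefD (leq_trans (size_polyD _ _)) // geq_max dterm andbT.
  by apply: (total_degree_leW _ drest); lia.
have shm c : shear c \is monic by rewrite /shear monicXaddC.
have tE : term n.+1 n.+1 = shear (-1) ^+ n.+1 * shear 1 ^+ n.+1.
  by rewrite /term divff // mul1r.
have tm : term n.+1 n.+1 \is monic by rewrite tE monicMl ?monic_exp.
have st : size (term n.+1 n.+1) = (n + n).+3.
  have sz c k : size (shear c ^+ k) = k.+1.
    have : (0 < size (shear c ^+ k))%N.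
      by rewrite size_poly_gt0 monic_neq0 // monic_exp.
    have := size_exp (shear c) k; rewrite [size (shear c)]size_XaddC /= mul1n.
    by move: (size (shear c ^+ k)) => s; lia.
  by rewrite tE size_Mmonic ?monic_exp ?monic_neq0 ?monic_exp // !sz; lia.
have sr : (size rest < size (term n.+1 n.+1))%N.
  by rewrite st ltnS (leq_trans (total_degree_le_size drest)) //; lia.
split; last by rewrite sE addrC size_polyDl.
by rewrite monicE sE addrC lead_coefDl // (monicP tm).
Qed.

(** Stability up to the real boundary. *)
Definition strictly_stable a n := forall z1 z2,
  0 <= 'Im z1 -> 0 <= 'Im z2 -> bival a n z1 z2 != 0.

(** If Im r >= 0 and t is real then r - t and r + t are both in the closed upper
half-plane. *)
Lemma sheared_roots a n : a n n != 0 -> strictly_stable a n ->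
  forall t r, t \is Num.real ->
  root (map_poly (horner_eval t) (sheared a n)) r -> 'Im r < 0.
Proof.
move=> an0 ast t r tR; rewrite /root.
have -> : (map_poly (horner_eval t) (sheared a n)).[r] = (sheared a n).[r%:P].[t].
  have {1}-> : r = horner_eval t r%:P by rewrite /horner_eval hornerC.
  by rewrite horner_map.
rewrite sheared_eval real_ltNge ?Creal_Im ?real0 // => h; apply/negP => rI.
have tI : 'Im t = 0 by apply/Creal_ImP.
move: h; rewrite mulf_eq0 (negbTE (ast _ _ _ _)) ?raddfB ?raddfD /= ?tI ?subr0 ?addr0 //=.
by rewrite invr_eq0 (negbTE an0).
Qed.


Lemma horner_char_poly (R : comNzRingType) m (M : 'M[R]_m) x :
  (char_poly M).[x] = \det (x%:M - M).
Proof.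
rewrite /char_poly -[LHS]/(horner_eval x _) -det_map_mx; congr determinant.
apply/matrixP => i j; rewrite !mxE /= /horner_eval hornerD hornerN hornerC.
by rewrite hornerMn hornerX.
Qed.

(** The characteristic polynomial of D is the top degree part of the polynomial at
y = 1, here (X^2 - 1)^(n+1): rescale (x, y) by 1/s and let s be 0 in the
resulting identity between polynomials in s. Then D^2 - 1 is nilpotent by
Cayley-Hamilton, and zero since it is Hermitian. *)
Lemma leading_form_square a n (A D : 'M[C]_((n + n).+2)) X :
  a n.+1 n.+1 != 0 -> D ^t* = D ->
  (forall x y, \det (x%:M - y *: D - X) = (sheared a n.+1).[x%:P].[y]) ->
  D *m D = 1%:M.
Proof.
move=> an0 Dh rep.
have lead b : \det (b%:M - D) = ((b - 1) * (b + 1)) ^+ n.+1.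
  pose p1 := \det (map_mx polyC (b%:M - D) - 'X *: map_mx polyC X).
  pose p2 : {poly C} := \sum_(j < n.+2) \sum_(k < n.+2)
    (a j k / a n.+1 n.+1 * ((b - 1) ^+ j * (b + 1) ^+ k)) *: 'X^((n + n).+2 - (j + k)).
  have p1E s : p1.[s] = \det (b%:M - D - s *: X).
    rewrite /p1 -[LHS]/(horner_eval s _) -det_map_mx; congr determinant.
    by apply/matrixP => i j; rewrite !mxE /= /horner_eval !(hornerE, hornerMn).
  have p2E s : p2.[s] = \sum_(j < n.+2) \sum_(k < n.+2)
      a j k / a n.+1 n.+1 * ((b - 1) ^+ j * (b + 1) ^+ k) * s ^+ ((n + n).+2 - (j + k)).
    rewrite /p2 horner_sum; apply: eq_bigr => j _; rewrite horner_sum; apply: eq_bigr => k _.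
    by rewrite hornerZ hornerXn.
  have p12 : p1 = p2.
    suff : 'X * p1 = 'X * p2 by apply: mulfI; rewrite polyX_eq0.
    apply: eq_poly_real => s _; rewrite !hornerM hornerX.
    have [->|s0] := eqVneq s 0; first by rewrite !mul0r.
    congr (_ * _); rewrite p1E p2E.
    have -> : b%:M - D - s *: X = s *: ((b / s)%:M - s^-1 *: D - X).
      by rewrite !scalerBr scalerA mulfV // scale1r scale_scalar_mx mulrCA mulfV // mulr1.
    rewrite detZ rep sheared_eval /bival mulr_suml mulr_sumr; apply: eq_bigr => j _.
    rewrite mulr_suml mulr_sumr; apply: eq_bigr => k _.
    have -> : b / s - s^-1 = (b - 1) / s by rewrite mulrBl mul1r.
    have -> : b / s + s^-1 = (b + 1) / s by rewrite mulrDl mul1r.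
    rewrite !expr_div_n -[X in s ^+ X](@subnK (j + k)); last first.
      by have := ltn_ord k; have := ltn_ord j; lia.
    rewrite !exprD; field; rewrite an0 !expf_neq0 //.
  have := congr1 (fun p : {poly C} => p.[0]) p12; rewrite p1E p2E scale0r subr0 => ->.
  rewrite big_ord_recr /= [X in _ + X]big_ord_recr /= big1 ?add0r => [|j _].
    rewrite big1 ?add0r => [|k _].
      by rewrite addSn addnS subnn expr0 divff // mulr1 mul1r exprMn.
    by rewrite expr0n (_ : (_ == 0)%N = false) ?mulr0 //; have := ltn_ord k; lia.
  rewrite big1 // => k _; rewrite expr0n (_ : (_ == 0)%N = false) ?mulr0 //.
  by have := ltn_ord k; have := ltn_ord j; lia.
have cD : char_poly D = ('X ^+ 2 - 1) ^+ n.+1.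
  apply: eq_poly_real => t _; rewrite horner_char_poly lead horner_exp !hornerE.
  by congr (_ ^+ _); ring.
have : (D ^+ 2 - 1) ^+ n.+1 = 0.
  have := Cayley_Hamilton D; rewrite cD !rmorphXn /= rmorphB /= rmorph1 rmorphXn /=.
  by rewrite horner_mx_X.
move/hermitian_nilpotent => h; apply/eqP; rewrite -subr_eq0; apply/eqP; apply: h.
rewrite linearB /= map_mxB expr2 [_ * _]/(_ *m _) trmx_mul map_mxM Dh.
by rewrite trmx1 map_mx1.
Qed.


Lemma coef_prod_linear m (l : 'I_m -> C) :
  let p : {poly C} := \prod_i (1 + l i *: 'X) in
  [/\ p`_0 = 1, p`_1 = \sum_i l i & p`_2 *+ 2 = (\sum_i l i) ^+ 2 - \sum_i l i ^+ 2].
Proof.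
apply: (big_ind3 (fun (p : {poly C}) (s1 s2 : C) =>
  [/\ p`_0 = 1, p`_1 = s1 & p`_2 *+ 2 = s1 ^+ 2 - s2])).
- by rewrite !coef1 /=; split=> //; rewrite mul0rn; ring.
- move=> p s1 s2 q t1 t2 [p0 p1 p2] [q0 q1 q2].
  rewrite !coefM !big_ord_recr !big_ord0 /= p0 p1 q0 q1; split; try by ring.
  have -> : (0 + 1 * q`_2 + s1 * t1 + p`_2 * 1) *+ 2 = q`_2 *+ 2 + p`_2 *+ 2 + s1 * t1 *+ 2 by ring.
  by rewrite p2 q2; ring.
- move=> i _; rewrite !coefD !coef1 !coefZ !coefX /=; split; try by ring.
Qed.

(** Compare the coefficients of t and t^2 on both sides. *)
Lemma bival_factor_sums a n m z1 z2 (l : 'I_m -> C) :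
  (forall t, bival a n.+2 (t * z1) (t * z2) = \prod_i (1 + t * l i)) ->
  \sum_i l i = z1 * a 1 0 + z2 * a 0 1 /\
  \sum_i l i ^+ 2 = (z1 * a 1 0 + z2 * a 0 1) ^+ 2
     - (z1 ^+ 2 * a 2 0 + z1 * z2 * a 1 1 + z2 ^+ 2 * a 0 2) *+ 2.
Proof.
move=> fac; pose W : {poly C} := \sum_(j < n.+3) \sum_(k < n.+3)
  (a j k * (z1 ^+ j * z2 ^+ k)) *: 'X^(j + k).
have WE : W = \prod_i (1 + l i *: 'X).
  apply: eq_poly_real => t _; rewrite horner_prod.
  under [RHS]eq_bigr => i _ do rewrite !hornerE mulrC.
  rewrite -fac /W /bival horner_sum; apply: eq_bigr => j _; rewrite horner_sum.
  apply: eq_bigr => k _; rewrite hornerZ hornerXn !exprMn exprD; ring.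
have [_] := coef_prod_linear l; rewrite -WE.
have cW s : W`_s = \sum_(j < n.+3) \sum_(k < n.+3)
    (a j k * (z1 ^+ j * z2 ^+ k)) * (s == (j + k)%N)%:R.
  rewrite /W coef_sum; apply: eq_bigr => j _; rewrite coef_sum; apply: eq_bigr => k _.
  by rewrite coefZ coefXn.
have diag (G : nat -> nat -> C) s : (s <= 2)%N ->
    \sum_(j < n.+3) \sum_(k < n.+3) G j k * (s == (j + k)%N)%:R =
    \sum_(j < 3) \sum_(k < 3) G j k * (s == (j + k)%N)%:R.
  have cut (F : nat -> C) : (forall j, (2 < j)%N -> F j = 0) ->
      \sum_(j < n.+3) F j = \sum_(j < 3) F j.
    move=> F0; rewrite -[n.+3]/(3 + n)%N big_split_ord /= [X in _ + X]big1 ?addr0 //.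
    by move=> j _; apply: F0; rewrite /= ltnS leq_addr.
  have off j k : (2 < j + k)%N -> (s <= 2)%N -> G j k * (s == (j + k)%N)%:R = 0.
    by move=> jk s2; rewrite (_ : (s == _) = false) ?mulr0 //; lia.
  move=> s2; rewrite (cut (fun j => \sum_(k < n.+3) G j k * (s == (j + k)%N)%:R)).
    apply: eq_bigr => j _; rewrite (cut (fun k => G j k * (s == (j + k)%N)%:R)) // => k k2.
    by rewrite off //; lia.
  by move=> j j2; rewrite big1 // => k _; rewrite off //; lia.
rewrite !cW !(diag (fun j k => a j k * (z1 ^+ j * z2 ^+ k))) //.
rewrite !big_ord_recr !big_ord0 /= !(mulr0, mulr1, addr0, add0r, expr0, mul1r, expr1).
move=> <- e2; split; first by rewrite addrC mulrC; congr (_ + _); rewrite mulrC.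
have -> := canRL (subKr _) (esym e2).
by rewrite !mulr2n; ring.
Qed.

Lemma trace_mulmx_adj_ge0 m k (A : 'M[C]_(m, k)) : 0 <= \tr (A *m A ^t*).
Proof.
apply: sumr_ge0 => i _; rewrite mxE sumr_ge0 // => j _.
by rewrite !mxE mul_conjC_ge0.
Qed.

(** W W^* = |z1|^2 K B1 K^* + |z2|^2 K B2 K^*, and both K B1 K^*, K B2 K^* are
positive semidefinite. *)
Lemma frobenius_orthogonal_split m (K B1 B2 : 'M[C]_m) (z1 z2 r : C) :
  B1 ^t* = B1 -> B2 ^t* = B2 -> B1 *m B1 = B1 -> B2 *m B2 = B2 ->
  B1 *m B2 = 0 -> B2 *m B1 = 0 -> B1 + B2 = 1%:M -> `|z1| <= r -> `|z2| <= r ->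
  forall W, W = K *m (z1 *: B1 + z2 *: B2) ->
  \tr (W *m W ^t*) <= r ^+ 2 * \tr (K *m K ^t*).
Proof.
move=> B1h B2h B11 B22 B12 B21 B1B2 zr1 zr2 W WE.
have tg B : B ^t* = B -> B *m B = B -> 0 <= \tr (K *m B *m K ^t*).
  move=> Bh BB; have := trace_mulmx_adj_ge0 (K *m B).
  by rewrite trmx_mul map_mxM Bh mulmxA -[K *m B *m B]mulmxA BB.
have -> : \tr (W *m W ^t*) =
    `|z1| ^+ 2 * \tr (K *m B1 *m K ^t*) + `|z2| ^+ 2 * \tr (K *m B2 *m K ^t*).
  have <- : \tr (K *m (`|z1| ^+ 2 *: B1 + `|z2| ^+ 2 *: B2) *m K ^t*) =
      `|z1| ^+ 2 * \tr (K *m B1 *m K ^t*) + `|z2| ^+ 2 * \tr (K *m B2 *m K ^t*).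
    by rewrite mulmxDr mulmxDl -!scalemxAr -!scalemxAl mxtraceD !mxtraceZ.
  rewrite WE trmx_mul map_mxM mulmxA; congr (\tr (_ *m _)).
  rewrite -mulmxA; congr (_ *m _).
  rewrite !linearD /= !linearZ /= map_mxD !map_mxZ B1h B2h.
  rewrite mulmxDl !mulmxDr -!scalemxAl -!scalemxAr B11 B22 B12 B21 !scaler0.
  by rewrite addr0 add0r !scalerA -!normCK.
have -> : \tr (K *m K ^t*) = \tr (K *m B1 *m K ^t*) + \tr (K *m B2 *m K ^t*).
  by rewrite -mxtraceD -mulmxDl -mulmxDr B1B2 mulmx1.
have r0 : 0 <= r by apply: le_trans zr1.
by rewrite mulrDr lerD // ler_wpM2r ?tg // lerXn2r // nnegrE.
Qed.

(** Write K = X - i u u^* with X Hermitian and b = |u|^2 = - Im tr K. The norm of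
a rank one matrix is its trace, so ||K||^2 = tr X^2 + b^2, while
Re tr K^2 = tr X^2 - b^2 and |tr K|^2 - Re (tr K)^2 = 2 b^2. *)
Lemma frobenius_rank1_imaginary m (K : 'M[C]_m) (u : 'cV[C]_m) :
  K - K ^t* = - (2 * 'i) *: (u *m u ^t*) ->
  \tr (K *m K ^t*) = `|\tr K| ^+ 2 - 'Re ((\tr K) ^+ 2 - \tr (K *m K)).
Proof.
move=> KK; pose b := (u ^t* *m u) 0 0; pose k := (u ^t* *m K *m u) 0 0.
have tru A : \tr (A *m (u *m u ^t*)) = (u ^t* *m A *m u) 0 0.
  by rewrite mulmxA mxtrace_mulC /mxtrace big_ord1 mulmxA.
have trc (A : 'M[C]_m) : \tr (A ^t*) = (\tr A)^*.
  by rewrite /mxtrace rmorph_sum; apply: eq_bigr => i _; rewrite !mxE.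
have sb : \tr K - (\tr K)^* = - (2 * 'i) * b.
  by rewrite -trc -linearB KK linearZ /= -[u *m u ^t*]mul1mx tru mulmx1.
have kc : k^* = (u ^t* *m K ^t* *m u) 0 0.
  have -> : u ^t* *m K ^t* *m u = (u ^t* *m K *m u) ^t*.
    by rewrite !trmx_mul !map_mxM trmxCK mulmxA.
  by rewrite /k [RHS]mxE [in RHS]mxE.
have kb : k - k^* = - (2 * 'i) * b ^+ 2.
  rewrite kc /k; have -> (A B : 'M[C]_1) : A 0 0 - B 0 0 = (A - B) 0 0 by rewrite !mxE.
  rewrite -mulmxBl -mulmxBr KK -scalemxAr -scalemxAl mxE; congr (_ * _).
  have -> : u ^t* *m (u *m u ^t*) *m u = (u ^t* *m u) *m (u ^t* *m u) by rewrite !mulmxA.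
  by rewrite mxE big_ord1 expr2.
have KKt : \tr (K *m K ^t*) = \tr (K *m K) + 2 * 'i * k.
  have -> : K ^t* = K + (2 * 'i) *: (u *m u ^t*).
    by rewrite -[K ^t*](subKr K) KK scaleNr opprK.
  by rewrite mulmxDr -scalemxAr linearD /= linearZ /= tru.
have real : (\tr (K *m K ^t*))^* = \tr (K *m K ^t*).
  by rewrite conj_Creal // ger0_real // trace_mulmx_adj_ge0.
have KKc : \tr (K *m K ^t*) = (\tr (K *m K))^* - 2 * 'i * k^*.
  by rewrite -real KKt rmorphD !rmorphM /= conjCi (conj_Creal (realn _ _)) mulrN mulNr.
apply: (mulfI (_ : 2 != 0 :> C)); first by rewrite pnatr_eq0.
have -> : 2 * \tr (K *m K ^t*) =
   \tr (K *m K) + (\tr (K *m K))^* + 2 * 'i * (k - k^*).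
  by rewrite mulr2n mulrDl mul1r {1}KKt KKc; ring.
have b2 : 4 * b ^+ 2 = - (\tr K - (\tr K)^*) ^+ 2.
  by rewrite sb exprMn sqrrN exprMn sqrCi; ring.
rewrite kb normCK ReE rmorphB rmorphXn /=.
have -> : 2 * 'i * (- (2 * 'i) * b ^+ 2) = - 4 * b ^+ 2 * 'i ^+ 2 :> C by ring.
by rewrite sqrCi mulrN1 mulNr opprK b2; field.
Qed.

Theorem strictly_stable_eigenvalues a n (z1 z2 r : C) :
  strictly_stable a n.+2 -> a n.+2 n.+2 != 0 -> a 0 0 = 1 ->
  `|z1| <= r -> `|z2| <= r ->
  exists m, exists l : 'I_m.+1 -> C,
    (forall t, bival a n.+2 (t * z1) (t * z2) = \prod_i (1 + t * l i)) /\
    \sum_i `|l i| ^+ 2 <= r ^+ 2 *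
      (`|a 1 0 + a 0 1| ^+ 2 - 'Re ((a 2 0 + a 1 1 + a 0 2) *+ 2)).
Proof.
move=> ast an0 a00 zr1 zr2; pose N := (n.+1 + n.+1)%N.
have [dQ /(_ an0) [Qm sQ]] := sheared_degree a n.+1.
have [|||A [D [v [Ah Dh rep]]]] := @determinantal_representation C N _ Qm sQ.
- by apply: leq_trans (dQ _) _; rewrite /N; lia.
- by apply: leq_trans (dQ _) _; rewrite /N; lia.
- exact: sheared_roots.
pose G := - A + 'i *: (v *m v ^t*).
have DD : D *m D = 1%:M.
  apply: (@leading_form_square a n.+1 A D (- G)) => // x y.
  rewrite -rep; congr determinant; rewrite /G opprK addrA; congr (_ + _).
  by rewrite addrAC.
pose B1 := 2^-1 *: (1%:M + D); pose B2 := 2^-1 *: (1%:M - D).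
(* (w1 + w2)/2 and (w2 - w1)/2 are the sheared coordinates of (w1, w2). *)
have repG w1 w2 : \det (G + (w1 *: B1 + w2 *: B2)) = bival a n.+2 w1 w2 / a n.+2 n.+2.
  pose x := (w1 + w2) / 2; pose y := (w2 - w1) / 2.
  have -> : bival a n.+2 w1 w2 / a n.+2 n.+2 = (sheared a n.+2).[x%:P].[y].
    by rewrite sheared_eval; congr (bival _ _ _ _ / _); rewrite /x /y; field.
  rewrite -rep; congr determinant; apply/matrixP => i j.
  rewrite /G /B1 /B2 !mxE /x /y.
  by case: (i == j); rewrite ?mulr1n ?mulr0n; field.
have b00 : bival a n.+2 0 0 = 1.
  have z0 (F : nat -> C) : \sum_(k < n.+3) F k * 0 ^+ k = F 0.
    by rewrite big_ord_recl big1 ?addr0 ?mulr1 // => k _; rewrite exprS mul0r mulr0.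
  rewrite /bival -a00 -(z0 (fun j => a j 0)); apply: eq_bigr => j _.
  by rewrite -(z0 (fun k => a j k)) mulr_suml; apply: eq_bigr => k _; rewrite mulrCA mulrC.
have detG : \det G = (a n.+2 n.+2)^-1.
  by have := repG 0 0; rewrite !scale0r !addr0 b00 mul1r.
have Gu : G \in unitmx by rewrite unitmxE detG unitfE invr_eq0.
pose K := invmx G.
have rep1 w1 w2 : bival a n.+2 w1 w2 = \det (1%:M + K *m (w1 *: B1 + w2 *: B2)).
  have -> : 1%:M + K *m (w1 *: B1 + w2 *: B2) = K *m (G + (w1 *: B1 + w2 *: B2)).
    by rewrite [RHS]mulmxDr mulVmx.
  by rewrite det_mulmx repG det_inv detG invrK mulrCA divff // mulr1.
have B12 : B1 + B2 = 1%:M.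
  by rewrite /B1 /B2 -scalerDr addrACA subrr addr0 -mulr2n -scaler_nat scalerA
    mulVf ?pnatr_eq0 // scale1r.
have hC : (2^-1)^* = 2^-1 :> C by rewrite conj_Creal // rpredV realn.
have B1h : B1 ^t* = B1 by rewrite linearZ /= map_mxZ /= hC linearD /= map_mxD trmx1 map_mx1 Dh.
have B2h : B2 ^t* = B2 by rewrite linearZ /= map_mxZ /= hC linearB /= map_mxB trmx1 map_mx1 Dh.
have mulB (s t : C) : (2^-1 *: (1%:M + s *: D)) *m (2^-1 *: (1%:M + t *: D)) =
    (4^-1 * (1 + s * t)) *: 1%:M + (4^-1 * (s + t)) *: D.
  rewrite -scalemxAl -scalemxAr mulmxDl !mulmxDr -!scalemxAl -!scalemxAr DD !mul1mx !mulmx1.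
  by apply/matrixP => i j; rewrite !mxE; field.
have B1E : B1 = 2^-1 *: (1%:M + 1 *: D) by rewrite scale1r.
have B2E : B2 = 2^-1 *: (1%:M + (-1) *: D) by rewrite scaleN1r.
have B11 : B1 *m B1 = B1.
  by rewrite B1E mulB scalerDr scalerA; congr (_ *: _ + _ *: _); field.
have B22 : B2 *m B2 = B2.
  by rewrite B2E mulB scalerDr scalerA; congr (_ *: _ + _ *: _); field.
have B12_0 : B1 *m B2 = 0.
  by rewrite B1E B2E mulB; apply/matrixP => i j; rewrite !mxE; ring.
have B21_0 : B2 *m B1 = 0.
  by rewrite B1E B2E mulB; apply/matrixP => i j; rewrite !mxE; ring.
have Gh : G ^t* - G = - (2 * 'i) *: (v *m v ^t*).
  rewrite /G linearD /= linearN /= linearZ /= map_mxD map_mxN map_mxZ /= Ah conjCi.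
  rewrite trmx_mul map_mxM trmxCK; apply/matrixP => i j; rewrite !mxE.
  by move: (\sum_j0 _) => w; ring.
have KK : K - K ^t* = - (2 * 'i) *: ((K *m v) *m (K *m v) ^t*).
  have -> : K - K ^t* = K *m (G ^t* - G) *m K ^t*.
    rewrite mulmxBr mulmxBl mulVmx // mul1mx -mulmxA -map_mxM -trmx_mul mulVmx //.
    by rewrite trmx1 map_mx1 mulmx1.
  by rewrite Gh -scalemxAr -scalemxAl trmx_mul map_mxM !mulmxA.
have [l [lfac ltr ltr2 lnorm]] := schur_eigenvalues (K *m (z1 *: B1 + z2 *: B2)).
exists N.+1, l; split=> [t|].
  by rewrite rep1 -lfac -!scalerA -scalerDr -scalemxAr.
apply: (le_trans lnorm).
have -> : `|a 1 0 + a 0 1| ^+ 2 - 'Re ((a 2 0 + a 1 1 + a 0 2) *+ 2) = \tr (K *m K ^t*).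
  have [k [kfac ktr ktr2 _]] := schur_eigenvalues K.
  have [|s1 s2] := @bival_factor_sums a n _ 1 1 k.
    move=> t; rewrite !mulr1 rep1 -kfac -scalerDr B12 -scalemxAr mulmx1 //.
  rewrite (frobenius_rank1_imaginary KK) -ktr -ktr2 s2 s1 !mul1r expr1n !mul1r.
  by rewrite subKr.
exact: (frobenius_orthogonal_split B1h B2h B11 B22 B12_0 B21_0 B12 zr1 zr2 erefl).
Qed.

End StrictlyStable.

(** * Pulling a stable polynomial back by a contraction of the half-plane *)

Section Contraction.
Variable C : numClosedFieldType.

(** The contribution of z^j to the pulled back polynomial: the j-th power of
(z + i e)/(1 - i e z) multiplied by (1 - i e z)^N. *)
Definition mobius_factor (e : C) N j : {poly C} :=
  ('X + ('i * e)%:P) ^+ j * (1 - ('i * e) *: 'X) ^+ (N - j).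

(** Coefficients of the product of (1 - i e z1)^N (1 - i e z2)^N and of the
polynomial b at the two transformed variables, see [bival_mobius_pullback]. *)
Definition mobius_pullback (b : nat -> nat -> C) N (e : C) l m : C :=
  \sum_(j < N.+1) \sum_(k < N.+1) b j k * ((mobius_factor e N j)`_l * (mobius_factor e N k)`_m).

Lemma size_mobius_denominator (e : C) k : e != 0 ->
  size ((1 - ('i * e) *: 'X) ^+ k : {poly C}) = k.+1 /\
  lead_coef ((1 - ('i * e) *: 'X) ^+ k : {poly C}) = (- ('i * e)) ^+ k.
Proof.
move=> e0; have ie0 : - ('i * e) != 0 by rewrite oppr_eq0 mulf_neq0 ?neq0Ci.
have s2 : size (1 - ('i * e) *: 'X : {poly C}) = 2.
  rewrite addrC -scaleNr size_polyDl ?size_scale ?size_polyX //.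
  by rewrite size_poly1.
have l1 : lead_coef (1 - ('i * e) *: 'X : {poly C}) = - ('i * e).
  rewrite addrC -scaleNr lead_coefDl ?size_scale ?size_polyX ?size_poly1 //.
  by rewrite lead_coefZ lead_coefX mulr1.
split; last by rewrite lead_coef_exp l1.
have := size_exp (1 - ('i * e) *: 'X : {poly C}) k; rewrite s2 mul1n.
have : (0 < size ((1 - ('i * e) *: 'X) ^+ k : {poly C}))%N.
  by rewrite size_poly_gt0 expf_neq0 // -size_poly_gt0 s2.
by move: (size _) => s; lia.
Qed.

Lemma mobius_factor_size (e : C) N j : e != 0 -> (j <= N)%N ->
  size (mobius_factor e N j) = N.+1 /\ (mobius_factor e N j)`_N = (- ('i * e)) ^+ (N - j).
Proof.
move=> e0 jN; have [s2 l2] := size_mobius_denominator (N - j) e0.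
have s1 : size (('X + ('i * e)%:P) ^+ j : {poly C}) = j.+1.
  have := size_exp ('X + ('i * e)%:P : {poly C}) j; rewrite size_XaddC mul1n.
  have : (0 < size (('X + ('i * e)%:P) ^+ j : {poly C}))%N.
    by rewrite size_poly_gt0 monic_neq0 // monic_exp ?monicXaddC.
  by move: (size _) => s; lia.
have sN : size (mobius_factor e N j) = N.+1.
  rewrite /mobius_factor size_mul -?size_poly_gt0 ?s1 ?s2 //.
  by rewrite addSn /= addnS subnKC.
have lc : lead_coef (mobius_factor e N j) = (- ('i * e)) ^+ (N - j).
  by rewrite [lead_coef _]lead_coefM l2 (monicP _) ?mul1r // monic_exp ?monicXaddC.
by split; rewrite // -lc /lead_coef sN.
Qed.

Lemma mobius_factor_eval (e z : C) N j : (mobius_factor e N j).[z] = (z + 'i * e) ^+ j * (1 - 'i * e * z) ^+ (N - j).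
Proof. by rewrite /mobius_factor !(hornerM, horner_exp, hornerE). Qed.

Lemma bival_mobius_pullback b N e z1 z2 : e != 0 -> bival (mobius_pullback b N e) N z1 z2 =
  \sum_(j < N.+1) \sum_(k < N.+1) b j k * ((mobius_factor e N j).[z1] * (mobius_factor e N k).[z2]).
Proof.
move=> e0; rewrite /bival /mobius_pullback.
under eq_bigr => l _ do under eq_bigr => m _ do rewrite mulr_suml.
under eq_bigr => l _ do rewrite exchange_big /=.
rewrite exchange_big /=; apply: eq_bigr => j _.
under eq_bigr => l _ do under eq_bigr => m _ do rewrite mulr_suml.
under eq_bigr => l _ do rewrite exchange_big /=.
rewrite exchange_big /=; apply: eq_bigr => k _.
have wide (i : 'I_N.+1) z : (mobius_factor e N i).[z] = \sum_(l < N.+1) (mobius_factor e N i)`_l * z ^+ l.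
  by apply: horner_coef_wide; have [-> //] := mobius_factor_size e0 (ltn_ord i : (i <= N)%N).
rewrite !wide mulr_suml mulr_sumr; apply: eq_bigr => l _.
rewrite mulr_sumr mulr_sumr; apply: eq_bigr => m _; ring.
Qed.

Lemma mobius_maps_closed_upper_inside (e z : C) : 0 < e -> 0 <= 'Im z ->
  1 - 'i * e * z != 0 /\ 0 < 'Im ((z + 'i * e) / (1 - 'i * e * z)).
Proof.
move=> e0 z0; pose x := 'Re z; pose y := 'Im z.
have eR : e \is Num.real by rewrite gtr0_real.
have xR : x \is Num.real by exact: Creal_Re.
have yR : y \is Num.real by exact: Creal_Im.
have zE : z = x + 'i * y by exact: Crect.
have ii : 'i * 'i = -1 :> C by rewrite -expr2 sqrCi.
pose d := (1 + e * y) ^+ 2 + (e * x) ^+ 2.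
have ey : 0 < 1 + e * y by rewrite ltr_pwDl // mulr_ge0 // ltW.
have d0 : 0 < d.
  by rewrite /d ltr_pwDl ?exprn_gt0 // -realEsqr rpredM.
have dE : (1 - 'i * e * z) * (1 + e * y + 'i * (e * x)) = d.
  rewrite zE /d; have -> : 1 - 'i * e * (x + 'i * y) = 1 - 'i * e * x - ('i * 'i) * e * y by ring.
  rewrite ii; have -> : (1 - 'i * e * x - -1 * e * y) * (1 + e * y + 'i * (e * x)) =
    (1 + e * y) ^+ 2 - ('i * 'i) * (e * x) ^+ 2 by ring.
  by rewrite ii; ring.
have n0 : 1 - 'i * e * z != 0.
  by apply: contraTneq d0 => h; rewrite -dE h mul0r ltxx.
split=> //.
have dn0 : d != 0 by rewrite gt_eqF.
have -> : (z + 'i * e) / (1 - 'i * e * z) =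
   (x - e * x * e) / d + 'i * ((e * x ^+ 2 + (y + e) * (1 + e * y)) / d).
  have -> : (1 - 'i * e * z)^-1 = (1 + e * y + 'i * (e * x)) / d.
    by apply: (mulfI n0); rewrite mulfV // [RHS]mulrA dE mulfV.
  rewrite mulrA zE.
  have -> : (x + 'i * y + 'i * e) * (1 + e * y + 'i * (e * x)) = x * (1 + e * y)
     + ('i * 'i) * (y + e) * (e * x) + 'i * (e * x ^+ 2 + (y + e) * (1 + e * y)) by ring.
  by rewrite ii; field.
have dR : d \is Num.real by rewrite gtr0_real.
rewrite Im_rect; last 2 first.
- by rewrite rpred_div // rpredB // !rpredM.
- by rewrite rpred_div // rpredD // rpredM ?rpredX ?rpredD ?rpredM ?rpred1.
apply: divr_gt0 => //; apply: ltr_wpDl.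
  by rewrite mulr_ge0 ?(ltW e0) // -realEsqr.
by rewrite mulr_gt0 // ltr_wpDl.
Qed.

(** The coefficient of z1^N z2^N is (- i e)^(2 N) times the value of b at
(i/e, i/e), the image of infinity, so it does not vanish either. *)
Theorem mobius_pullback_strictly_stable b N e : 0 < e ->
  (forall z1 z2, 0 < 'Im z1 -> 0 < 'Im z2 -> bival b N z1 z2 != 0) ->
  strictly_stable (mobius_pullback b N e) N /\ mobius_pullback b N e N N != 0.
Proof.
move=> e0 bst; have en0 : e != 0 by rewrite gt_eqF.
have clear_denom (d u : C) j : d != 0 -> (j <= N)%N ->
    u ^+ j * d ^+ (N - j) = d ^+ N * (u / d) ^+ j.
  move=> d0 jN; rewrite -[in RHS](subnK jN) exprD expr_div_n.
  by field; rewrite expf_neq0.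
split.
  move=> z1 z2 z1I z2I; rewrite bival_mobius_pullback //.
  have [d1 f1] := mobius_maps_closed_upper_inside e0 z1I; have [d2 f2] := mobius_maps_closed_upper_inside e0 z2I.
  have := bst _ _ f1 f2; apply: contraNneq => sum0.
  have : (1 - 'i * e * z1) ^+ N * (1 - 'i * e * z2) ^+ N *
      bival b N ((z1 + 'i * e) / (1 - 'i * e * z1)) ((z2 + 'i * e) / (1 - 'i * e * z2)) = 0.
    rewrite -[RHS]sum0 /bival mulr_sumr; apply: eq_bigr => j _.
    rewrite mulr_sumr; apply: eq_bigr => k _; rewrite !mobius_factor_eval.
    have jN : (j <= N)%N by rewrite -ltnS. have kN : (k <= N)%N by rewrite -ltnS.
    by rewrite !clear_denom //; ring.
  move/eqP; rewrite !mulf_eq0 !expf_eq0 (negbTE d1) (negbTE d2) !andbF /= => /eqP ->.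
  by rewrite eqxx.
have iI : 0 < 'Im ('i / e).
  have -> : 'i / e = 0 + 'i * e^-1 by rewrite add0r.
  by rewrite Im_rect ?rpred0 ?rpredV ?gtr0_real // invr_gt0.
have := bst _ _ iI iI; apply: contraNneq => sum0.
have ii : - ('i * e) = ('i / e)^-1.
  by rewrite invfM invrK invCi mulNr.
have n0 : 'i / e != 0 by rewrite mulf_neq0 ?neq0Ci ?invr_eq0.
suff : ('i / e)^-1 ^+ N * ('i / e)^-1 ^+ N * bival b N ('i / e) ('i / e) = 0.
  by move/eqP; rewrite !mulf_eq0 !expf_eq0 !invr_eq0 (negbTE n0) !andbF.
rewrite -[RHS]sum0 /bival mulr_sumr; apply: eq_bigr => j _.
rewrite mulr_sumr; apply: eq_bigr => k _.
have jN : (j <= N)%N by rewrite -ltnS. have kN : (k <= N)%N by rewrite -ltnS.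
have [_ ->] := mobius_factor_size en0 jN; have [_ ->] := mobius_factor_size en0 kN.
have iV0 : ('i / e)^-1 != 0 by rewrite invr_eq0.
rewrite ii; have := clear_denom ('i / e)^-1 1 j iV0 jN; rewrite expr1n !mul1r invrK => ->.
have := clear_denom ('i / e)^-1 1 k iV0 kN; rewrite expr1n !mul1r invrK => ->.
by ring.
Qed.

End Contraction.

(** * Bivariate multinomials as coefficient arrays *)

Section Bivariate.
Variable C : numClosedFieldType.
Implicit Type p : mpoly.mpoly 2 C.

Definition mnm2 (j k : nat) : mpoly.multinom 2 := mpoly.Multinom [tuple j; k].

Lemma mnm2_0 j k : mnm2 j k ord0 = j. Proof. by []. Qed.
Lemma mnm2_1 j k : mnm2 j k ord_max = k. Proof. by []. Qed.

Definition coef2 p j k : C := mpoly.mcoeff (mnm2 j k) p.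

Lemma mnm2P (m : mpoly.multinom 2) : m = mnm2 (m ord0) (m ord_max).
Proof. by apply/mpoly.mnmP; case=> [[|[|//]] i2]; congr (m _); apply/val_inj. Qed.

Lemma meval_bival p N (z : 'I_2 -> C) : (mpoly.mmeasure mpoly.mdeg p <= N.+1)%N ->
  mpoly.meval z p = bival (coef2 p) N (z ord0) (z ord_max).
Proof.
move=> sp; rewrite mpoly.mevalE /bival.
have E j k : coef2 p j k * (z ord0 ^+ j * z ord_max ^+ k) =
   \sum_(m <- mpoly.msupp p) (m == mnm2 j k)%:R *
     (mpoly.mcoeff m p * \prod_i z i ^+ m i).
  have [jk|jk] := boolP (mnm2 j k \in mpoly.msupp p).
    rewrite (bigD1_seq _ jk) ?mpoly.msupp_uniq //= eqxx mul1r.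
    rewrite [X in _ + X]big1 => [|m mn]; last by rewrite (negbTE mn) mul0r.
    rewrite addr0 !big_ord_recl big_ord0 mulr1; congr (_ * (_ * z _ ^+ _)).
    exact: val_inj.
  rewrite /coef2 mpoly.memN_msupp_eq0 // mul0r big_seq big1 // => m ms.
  by rewrite (_ : (m == _) = false) ?mul0r //; apply: contraNF jk => /eqP <-.
under [RHS]eq_bigr => j _ do (under eq_bigr => k _ do rewrite E; rewrite exchange_big /=).
rewrite exchange_big /= big_seq [RHS]big_seq; apply: eq_bigr => m ms.
have lt i : (m i < N.+1)%N.
  apply: leq_trans sp; apply: leq_ltn_trans (mpoly.msize_mdeg_lt ms).
  by rewrite mpoly.mdegE (bigD1 i) //= leq_addr.
have mneq j k : (j != m ord0) || (k != m ord_max) -> (m == mnm2 j k) = false.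
  by move=> jk; apply/negbTE; apply: contraTneq jk => ->; rewrite mnm2_0 mnm2_1 !eqxx.
rewrite (bigD1 (Ordinal (lt ord0))) //= [X in _ + X]big1 ?addr0 => [|j jn]; last first.
  by rewrite big1 // => k _; rewrite mneq ?mul0r //; apply/orP; left; exact: jn.
rewrite (bigD1 (Ordinal (lt ord_max))) //= [X in _ + X]big1 ?addr0 => [|k kn]; last first.
  by rewrite mneq ?mul0r //; apply/orP; right; exact: kn.
by rewrite -mnm2P eqxx mul1r.
Qed.

Lemma meval_zero p : mpoly.meval (fun _ => 0) p = coef2 p 0 0.
Proof.
have := @meval_bival p (mpoly.mmeasure mpoly.mdeg p) (fun _ => 0) (leqnSn _) => ->.
rewrite /bival big_ord_recl [X in _ + X]big1 => [|j _]; last first.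
  by rewrite big1 // => k _; rewrite exprS !mul0r mulr0.
rewrite big_ord_recl big1 => [|k _]; last by rewrite exprS mul0r !mulr0.
by rewrite !mulr1 !addr0.
Qed.

Lemma coef2_mderiv0 p j k :
  coef2 (mpoly.mderiv ord0 p) j k = coef2 p j.+1 k *+ j.+1.
Proof.
rewrite /coef2 mpoly.mcoeff_deriv mnm2_0; congr (mpoly.mcoeff _ p *+ _).
apply/mpoly.mnmP; case=> [[|[|//]] i2]; rewrite mpoly.mnmDE mpoly.mnm1E.
  by rewrite /= addn1.
by rewrite /= addn0.
Qed.

Lemma coef2_mderiv1 p j k :
  coef2 (mpoly.mderiv ord_max p) j k = coef2 p j k.+1 *+ k.+1.
Proof.
rewrite /coef2 mpoly.mcoeff_deriv mnm2_1; congr (mpoly.mcoeff _ p *+ _).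
apply/mpoly.mnmP; case=> [[|[|//]] i2]; rewrite mpoly.mnmDE mpoly.mnm1E.
  by rewrite /= addn0.
by rewrite /= addn1.
Qed.

End Bivariate.

(** * The bound, and its passage to the limit *)

Section Limit.
Variable R : realType.
Local Notation C := R[i].
Implicit Types (w : C).
Local Notation Re := (@complex.Re R).
Local Notation Im := (@complex.Im R).
Local Notation normc := (@Normc.normc R).

Lemma sqr_normcE w : normc w ^+ 2 = Re w ^+ 2 + Im w ^+ 2.
Proof. by case: w => a b; rewrite sqr_sqrtr // addr_ge0 // sqr_ge0. Qed.

Lemma numRe w : 'Re w = (Re w)%:C%C.
Proof. by rewrite ReE ReJ_add. Qed.

Lemma numIm_gt0 w : (0 < 'Im w) = (0 < Im w).
Proof.
have -> : 'Im w = (Im w)%:C%C by rewrite ImE ImJ_sub -mulrA mulrC.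
by rewrite ltcR.
Qed.

Lemma ReD : {morph Re : x y / x + y}.
Proof. by move=> [a b] [c d]. Qed.

Lemma num_norm w : `|w| = (normc w)%:C%C.
Proof. by []. Qed.

(** |1 + l|^2 = 1 + 2 Re l + |l|^2 is at most exp (2 Re l + |l|^2). *)
Lemma normc_prod_le_exp (I : finType) (l : I -> C) :
  normc (\prod_i (1 + l i)) ^+ 2 <=
  expR (2 * Re (\sum_i l i) + \sum_i normc (l i) ^+ 2).
Proof.
rewrite (_ : 2 * _ + _ = \sum_i (2 * Re (l i) + normc (l i) ^+ 2)); last first.
  by rewrite big_split /= -mulr_sumr -(big_morph _ ReD (erefl : Re 0 = 0)).
elim/big_rec2: _ => [|i x y _ xy]; first by rewrite Normc.normc1 expr1n expR0.
rewrite Normc.normcM exprMn expRD ler_pM ?sqr_ge0 //.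
have := expR_ge1Dx (2 * Re (l i) + normc (l i) ^+ 2); apply: le_trans.
rewrite !sqr_normcE; case: (l i) => a b /=; nra.
Qed.

Theorem strictly_stable_bound (a : nat -> nat -> C) n z1 z2 (r : R) :
  strictly_stable a n.+2 -> a n.+2 n.+2 != 0 -> a 0 0 = 1 ->
  normc z1 <= r -> normc z2 <= r ->
  normc (bival a n.+2 z1 z2) ^+ 2 <=
    expR (2 * Re (z1 * a 1 0 + z2 * a 0 1) +
      r ^+ 2 * (normc (a 1 0 + a 0 1) ^+ 2 - Re ((a 2 0 + a 1 1 + a 0 2) *+ 2))).
Proof.
move=> ast an0 a00 z1r z2r.
have [||m [l [lfac lsum]]] := @strictly_stable_eigenvalues C a n z1 z2 r%:C%C ast an0 a00;
  rewrite ?num_norm ?lecR //.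
have [sl _] := bival_factor_sums lfac.
have := lfac 1; rewrite !mul1r => ->.
under eq_bigr => i _ do rewrite mul1r.
apply: le_trans (normc_prod_le_exp l) _; rewrite ler_expR sl lerD2l.
move: lsum; rewrite numRe num_norm -!rmorphXn /= -rmorphB /= -rmorphM /=.
under eq_bigr => i _ do rewrite num_norm -rmorphXn.
by rewrite -rmorph_sum lecR.
Qed.


Local Open Scope classical_set_scope.
Import numFieldNormedType.Exports.

(** Convergence of complex sequences, through real and imaginary parts. *)
Definition cvgC (u : nat -> C) (l : C) :=
  (fun k => Re (u k)) @ \oo --> Re l /\ (fun k => Im (u k)) @ \oo --> Im l.

Lemma cvgC_cst l : cvgC (fun=> l) l.
Proof. by split; apply: cvg_cst. Qed.

Lemma cvgCD u v l m : cvgC u l -> cvgC v m -> cvgC (fun k => u k + v k) (l + m).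
Proof.
move=> [u1 u2] [v1 v2]; have ImD : {morph Im : x y / x + y} by move=> [? ?] [? ?].
by split; rewrite ?ReD ?ImD; under eq_cvg do rewrite ?ReD ?ImD; apply: cvgD.
Qed.

Lemma cvgCM u v l m : cvgC u l -> cvgC v m -> cvgC (fun k => u k * v k) (l * m).
Proof.
move=> [u1 u2] [v1 v2].
have ReM x y : Re (x * y) = Re x * Re y - Im x * Im y by case: x y => [? ?] [? ?].
have ImM x y : Im (x * y) = Re x * Im y + Im x * Re y by case: x y => [? ?] [? ?].
split; rewrite ?ReM ?ImM; under eq_cvg do rewrite ?ReM ?ImM.
  by apply: cvgB; apply: cvgM.
by apply: cvgD; apply: cvgM.
Qed.

Lemma cvgCV u l : l != 0 -> cvgC u l -> cvgC (fun k => (u k)^-1) l^-1.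
Proof.
move=> l0 [u1 u2].
have ReV x : Re x^-1 = Re x * (Re x * Re x + Im x * Im x)^-1 by case: x.
have ImV x : Im x^-1 = - (Im x * (Re x * Re x + Im x * Im x)^-1).
  by case: x.
have d0 : Re l * Re l + Im l * Im l != 0.
  apply: contra l0; case: l {u1 u2} => a b /=; rewrite paddr_eq0 ?sqr_ge0 -?expr2 ?sqr_ge0 //.
  by rewrite !sqrf_eq0 => /andP[/eqP -> /eqP ->].
have dV : (fun k => (Re (u k) * Re (u k) + Im (u k) * Im (u k))^-1) @ \oo -->
    (Re l * Re l + Im l * Im l)^-1.
  by apply: cvgV => //; apply: cvgD; apply: cvgM.
split; rewrite ?ReV ?ImV; under eq_cvg do rewrite ?ReV ?ImV.
  exact: cvgM.
by apply: cvgN; apply: cvgM.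
Qed.

Lemma cvgC_sum m (u : 'I_m -> nat -> C) l : (forall i, cvgC (u i) (l i)) ->
  cvgC (fun k => \sum_i u i k) (\sum_i l i).
Proof.
move=> ul; elim: m u l ul => [|m IH] u l ul.
  rewrite big_ord0; have -> : (fun k => \sum_i u i k) = fun=> 0.
    by apply/boolp.funext => k; rewrite big_ord0.
  exact: cvgC_cst.
rewrite big_ord_recr /=.
have -> : (fun k => \sum_i u i k) =
    (fun k => \sum_(i < m) u (widen_ord (leqnSn m) i) k + u ord_max k).
  by apply/boolp.funext => k; rewrite big_ord_recr.
by apply: cvgCD => //; apply: IH.
Qed.

Lemma cvg_sqr_normc u l : cvgC u l ->
  (fun k => normc (u k) ^+ 2) @ \oo --> normc l ^+ 2.
Proof.
move=> [u1 u2]; rewrite sqr_normcE; under eq_cvg do rewrite sqr_normcE.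
by apply: cvgD; rewrite expr2; under eq_cvg do rewrite expr2; apply: cvgM.
Qed.

Definition cvg_coef (P : nat -> {poly C}) (Q : {poly C}) :=
  forall i, cvgC (fun k => (P k)`_i) Q`_i.

Lemma cvg_coefM P1 Q1 P2 Q2 : cvg_coef P1 Q1 -> cvg_coef P2 Q2 ->
  cvg_coef (fun k => P1 k * P2 k) (Q1 * Q2).
Proof.
move=> c1 c2 i; rewrite coefM; under boolp.eq_fun do rewrite coefM.
by apply: cvgC_sum => j; apply: cvgCM.
Qed.

Lemma cvg_coefX P Q n : cvg_coef P Q -> cvg_coef (fun k => P k ^+ n) (Q ^+ n).
Proof.
move=> c; elim: n => [|n IH].
  by move=> i; rewrite expr0; under boolp.eq_fun do rewrite expr0; apply: cvgC_cst.
by rewrite exprS; under boolp.eq_fun do rewrite exprS; apply: cvg_coefM.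
Qed.

Definition eps k : C := (harmonic k)%:C%C.

Lemma cvgC_eps : cvgC eps 0.
Proof. by split; [exact: cvg_harmonic|exact: cvg_cst]. Qed.

Lemma cvg_coef_mobius_factor N j : cvg_coef (fun k => mobius_factor (eps k) N j) 'X^j.
Proof.
have ce : cvgC (fun k => 'i * eps k) 0.
  by rewrite -[X in cvgC _ X](mulr0 'i); apply: cvgCM; [exact: cvgC_cst|exact: cvgC_eps].
rewrite -[X in cvg_coef _ X]mulr1 -[X in _ * X](expr1n _ (N - j)).
apply: cvg_coefM; apply: cvg_coefX.
  move=> i; under boolp.eq_fun do rewrite coefD coefC.
  rewrite -[X in cvgC _ X]addr0; apply: cvgCD; first exact: cvgC_cst.
  by case: eqP => _ //; apply: cvgC_cst.
move=> i; under boolp.eq_fun do rewrite coefB coefZ -mulNr.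
rewrite -[X in cvgC _ X]addr0; apply: cvgCD; first exact: cvgC_cst.
rewrite -[X in cvgC _ X](mul0r ('X : {poly C})`_i); apply: cvgCM; last exact: cvgC_cst.
under boolp.eq_fun do rewrite -mulN1r.
by rewrite -[X in cvgC _ X](mulr0 (-1)); apply: cvgCM => //; apply: cvgC_cst.
Qed.

Lemma cvg_mobius_pullback b N l m : (l <= N)%N -> (m <= N)%N ->
  cvgC (fun k => mobius_pullback b N (eps k) l m) (b l m).
Proof.
move=> lN mN.
have -> : b l m = \sum_(j < N.+1) \sum_(k < N.+1) b j k * (('X^j : {poly C})`_l * ('X^k : {poly C})`_m).
  rewrite (bigD1 (Ordinal (lN : (l < N.+1)%N))) //= [X in _ + X]big1 ?addr0 => [|j jl]; last first.
    rewrite big1 // => k _; rewrite coefXn (_ : (l == j :> nat) = false) ?mul0r ?mulr0 //.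
    by apply/negbTE; rewrite eq_sym; exact: jl.
  rewrite (bigD1 (Ordinal (mN : (m < N.+1)%N))) //= [X in _ + X]big1 ?addr0 => [|k km]; last first.
    rewrite !coefXn (_ : (m == k :> nat) = false) ?mul0r ?mulr0 //.
    by apply/negbTE; rewrite eq_sym; exact: km.
  by rewrite !coefXn !eqxx !mulr1.
apply: cvgC_sum => j; apply: cvgC_sum => k; apply: cvgCM; first exact: cvgC_cst.
by apply: cvgCM; apply: cvg_coef_mobius_factor.
Qed.

(** The degree is at least 2 in each variable so that the coefficients of z1^2 and
z2^2 are among those of [bival]. *)
Theorem stable_bound (b : nat -> nat -> C) n z1 z2 (r : R) :
  (forall w1 w2, 0 < Im w1 -> 0 < Im w2 -> bival b n.+2 w1 w2 != 0) ->
  b 0 0 = 1 -> normc z1 <= r -> normc z2 <= r ->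
  normc (bival b n.+2 z1 z2) ^+ 2 <=
    expR (2 * Re (z1 * b 1 0 + z2 * b 0 1) +
      r ^+ 2 * (normc (b 1 0 + b 0 1) ^+ 2 - Re ((b 2 0 + b 1 1 + b 0 2) *+ 2))).
Proof.
move=> bst b00 z1r z2r; set N := n.+2.
(* Normalized so that the value at the origin is 1. *)
pose a k l m := mobius_pullback b N (eps k) l m / mobius_pullback b N (eps k) 0 0.
have eps0 k : 0 < eps k by rewrite ltcR harmonic_gt0.
have st k : strictly_stable (mobius_pullback b N (eps k)) N /\ mobius_pullback b N (eps k) N N != 0.
  by apply: mobius_pullback_strictly_stable => // w1 w2; rewrite !numIm_gt0; apply: bst.
have bival0 c : bival c N 0 0 = c 0%N 0%N :> C.
  have z0 (F : nat -> C) : \sum_(k < N.+1) F k * 0 ^+ k = F 0.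
    by rewrite big_ord_recl big1 ?addr0 ?mulr1 // => k _; rewrite exprS mul0r mulr0.
  rewrite /bival -(z0 (fun j => c j 0%N)); apply: eq_bigr => j _.
  by rewrite -(z0 (fun k => c j k)) mulr_suml; apply: eq_bigr => k _; rewrite mulrCA mulrC.
have c00 k : mobius_pullback b N (eps k) 0 0 != 0.
  by rewrite -bival0; apply: (st k).1; rewrite raddf0.
have bivala k w1 w2 : bival (a k) N w1 w2 =
    bival (mobius_pullback b N (eps k)) N w1 w2 / mobius_pullback b N (eps k) 0 0.
  rewrite /bival mulr_suml; apply: eq_bigr => i _; rewrite mulr_suml.
  by apply: eq_bigr => j _; rewrite mulrAC.
have bound k := @strictly_stable_bound (a k) n z1 z2 r.
have ca l m : (l <= N)%N -> (m <= N)%N -> cvgC (fun k => a k l m) (b l m).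
  move=> lN mN; rewrite -[X in cvgC _ X]divr1; apply: cvgCM; first exact: cvg_mobius_pullback.
  have c1 : cvgC (fun k => mobius_pullback b N (eps k) 0 0) 1 by rewrite -b00; apply: cvg_mobius_pullback.
  by have := cvgCV (oner_neq0 C) c1; rewrite invr1.
have Re_cvg u l : cvgC u l -> (fun k => Re (u k)) @ \oo --> Re l by case.
apply: (@ler_cvg_to _ \oo _ R (fun k => normc (bival (a k) N z1 z2) ^+ 2)
  (fun k => expR (2 * Re (z1 * a k 1%N 0%N + z2 * a k 0%N 1%N) +
    r ^+ 2 * (normc (a k 1%N 0%N + a k 0%N 1%N) ^+ 2 -
      Re ((a k 2%N 0%N + a k 1%N 1%N + a k 0%N 2%N) *+ 2))))).
- apply: cvg_sqr_normc; apply: cvgC_sum => j; apply: cvgC_sum => k.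
  by apply: cvgCM; [apply: ca; rewrite -ltnS|exact: cvgC_cst].
- apply: continuous_cvg; first exact: continuous_expR.
  have lin : cvgC (fun k => z1 * a k 1%N 0%N + z2 * a k 0%N 1%N) (z1 * b 1%N 0%N + z2 * b 0%N 1%N).
    by apply: cvgCD; apply: cvgCM; first [exact: cvgC_cst | apply: ca].
  apply: cvgD; first by apply: cvgM; [exact: cvg_cst|exact: Re_cvg].
  apply: cvgM; first exact: cvg_cst.
  apply: cvgB; first by apply: cvg_sqr_normc; apply: cvgCD; apply: ca.
  apply: Re_cvg; rewrite mulr2n; under boolp.eq_fun do rewrite mulr2n.
  by apply: cvgCD; apply: cvgCD; try apply: cvgCD; apply: ca.
- apply: nearW => k; apply: bound => //.
  + by move=> w1 w2 w1I w2I; rewrite bivala mulf_neq0 ?invr_eq0 ?c00 //; apply: (st k).1.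
  + by rewrite /a mulf_neq0 ?invr_eq0 ?c00 //; have [_] := st k.
  + by rewrite /a divff.
Qed.

End Limit.


Theorem theorem1p4 (R : realType) (p : mpoly.mpoly 2 R[i]) (hp : stable p)
    (hp0 : mpoly.meval (fun _ => 0) p = 1) (z : 'I_2 -> R[i]) :
  Normc.normc (mpoly.meval z p) <=
  expR (complex.Re (\sum_(j < 2) z j * partial0 p j)
        + 2^-1 * sup_norm z ^+ 2
          * (Normc.normc (\sum_(j < 2) partial0 p j) ^+ 2
             - complex.Re (\sum_(j < 2) \sum_(k < 2) partial20 p j k))).
Proof.
pose n := mpoly.mmeasure mpoly.mdeg p; pose b := coef2 p.
have evalE w : mpoly.meval w p = bival b n.+2 (w ord0) (w ord_max).
  by apply: meval_bival; rewrite -/n ltnW // ltnW.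
have lift01 : lift ord0 ord0 = ord_max :> 'I_2 by apply/val_inj.
have sum2 (F : 'I_2 -> R[i]) : \sum_j F j = F ord0 + F ord_max.
  by rewrite !big_ord_recl big_ord0 addr0 lift01.
have d0 : partial0 p ord0 = b 1%N 0%N by rewrite /partial0 meval_zero coef2_mderiv0.
have d1 : partial0 p ord_max = b 0%N 1%N by rewrite /partial0 meval_zero coef2_mderiv1.
have d00 : partial20 p ord0 ord0 = b 2%N 0%N *+ 2.
  by rewrite /partial20 meval_zero 2!coef2_mderiv0 mulr1n.
have d01 : partial20 p ord0 ord_max = b 1%N 1%N.
  by rewrite /partial20 meval_zero coef2_mderiv0 coef2_mderiv1 !mulr1n.
have d10 : partial20 p ord_max ord0 = b 1%N 1%N.
  by rewrite /partial20 meval_zero coef2_mderiv1 coef2_mderiv0 !mulr1n.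
have d11 : partial20 p ord_max ord_max = b 0%N 2%N *+ 2.
  by rewrite /partial20 meval_zero 2!coef2_mderiv1 mulr1n.
have d2 : \sum_(j < 2) \sum_(k < 2) partial20 p j k = (b 2%N 0%N + b 1%N 1%N + b 0%N 2%N) *+ 2.
  rewrite sum2 (sum2 (partial20 p ord0)) (sum2 (partial20 p ord_max)) d00 d01 d10 d11.
  by move: (b _ _) (b _ _) (b _ _) => x y w; rewrite !mulrnDl addrA -[y *+ 2]/(y + y) !addrA.
have normz j : Normc.normc (z j) <= sup_norm z.
  by rewrite /sup_norm (bigD1 j) //= le_max lexx.
have bst w1 w2 : 0 < complex.Im w1 -> 0 < complex.Im w2 -> bival b n.+2 w1 w2 != 0.
  move=> w1I w2I; have := hp (fun j : 'I_2 => if j == ord0 then w1 else w2).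
  by rewrite evalE; apply=> j; case: ifP.
have := @stable_bound R b n (z ord0) (z ord_max) (sup_norm z) bst _ (normz _) (normz _).
rewrite -evalE d2 (sum2 (fun j => z j * partial0 p j)) (sum2 (partial0 p)) d0 d1.
have b00 : b 0%N 0%N = 1 by rewrite -hp0 meval_zero.
move=> /(_ b00) bound; rewrite -(@ler_pXn2r _ 2) ?nnegrE ?expR_ge0 //.
  apply: le_trans bound _; rewrite -expRM_natl ler_expR le_eqVlt; apply/orP; left; apply/eqP.
  by rewrite [RHS]mulrDr; congr (_ + _); rewrite !mulrA mulfV ?mul1r ?pnatr_eq0.
by case: (mpoly.meval z p) => x y; apply: sqrtr_ge0.
Qed.
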